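(* Let $(\phi_t)$ be a non-elliptic semigroup in $\mathbb{D}$ with Koenigs function $h$, total speed $v(t)$, orthogonal speed $v^o(t)$ and tangential speed $v^T(t)$. Suppose $h(\mathbb{D})=p+iV(\alpha,\beta)$ for some $p\in\mathbb{C}$ and some $\alpha, \beta\in [0,\pi]$ with $\alpha+\beta>0$. \begin{enumerate} \item If $\alpha>0$ and $\beta>0$ then there exists $C>0$ such that $v^T(t)\leq C$ for all $t\ge 0$ and $$\left|v^o(t)-\frac{\pi}{2(\alpha+\beta)}\log t\right|\leq C, \qquad \left|v(t)-\frac{\pi}{2(\alpha+\beta)}\log t\right|\leq C,$$ for all $t\geq 1$. \item If either $\alpha=0$ or $\beta=0$ then there exists $C>0$ such that for all $t\geq 1$ $$\left|v(t)-\frac{\pi+\alpha+\beta}{2(\alpha+\beta)}\log t\right|\leq C,\qquad \left|v^o(t)-\frac{\pi}{2(\alpha+\beta)}\log t\right|\leq C,\qquad \left|v^T(t)-\frac{1}{2}\log t\right|\leq C.$$ \end{enumerate}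
   Context: For $\alpha,\beta\in[0,\pi]$ with $\alpha+\beta>0$, $V(\alpha,\beta):=\{re^{i\theta}:r>0,\ -\alpha<\theta<\beta\}$. Let $\mathbb{D}=\{\zeta\in\mathbb{C}:|\zeta|<1\}$ with hyperbolic distance $\omega(z,w)=\frac12\log\frac{1+|T_z(w)|}{1-|T_z(w)|}$, $T_z(w)=\frac{z-w}{1-\overline{z}w}$. A non-elliptic semigroup in $\mathbb{D}$ is a family $(\phi_t)_{t\ge0}$ of holomorphic maps $\phi_t:\mathbb{D}\to\mathbb{D}$ such that $\phi_0=\mathrm{id}$, $\phi_{t+s}=\phi_t\circ\phi_s$ for all $s,t\ge0$, $t\mapsto\phi_t$ is continuous for the topology of uniform convergence on compacta of $\mathbb{D}$, and $\phi_t$ has no fixed point in $\mathbb{D}$ for $t>0$. Its Denjoy-Wolff point is the unique $\tau\in\partial\mathbb{D}$ such that $\lim_{t\to\infty}\phi_t(z)=\tau$ for all $z\in\mathbb{D}$. Its Koenigs function is the (essentially unique) univalent map $h:\mathbb{D}\to\mathbb{C}$ such that $h(\mathbb{D})+it\subseteq h(\mathbb{D})$ and $h(\phi_t(z))=h(z)+it$ for all $z\in\mathbb{D}$, $t\ge0$, and such that $\bigcup_{t\ge0}(h(\mathbb{D})-it)$ is a vertical strip, a (right or left) half plane with vertical boundary, or $\mathbb{C}$. Let $\gamma:(-1,1)\to\mathbb{D}$, $\gamma(r)=r\tau$ (a geodesic), and for $z\in\mathbb{D}$ let $\pi_\gamma(z)$ be the unique point of $\gamma((-1,1))$ closest to $z$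 with respect to $\omega$. The total speed is $v(t):=\omega(0,\phi_t(0))$, the orthogonal speed is $v^o(t):=\omega(0,\pi_\gamma(\phi_t(0)))$ and the tangential speed is $v^T(t):=\omega(\phi_t(0),\pi_\gamma(\phi_t(0)))$, $t\ge0$. *)

(* Defs.v *)
From Stdlib Require Export Reals List ClassicalEpsilon.
From Coquelicot Require Export Coquelicot.
Open Scope R_scope.

Definition disc (z : C) : Prop := Cmod z < 1.

Definition holomorphic_on_disc (f : C -> C) : Prop :=
  forall z : C, disc z -> @ex_derive C_AbsRing C_NormedModule f z.

Definition univalent_on_disc (f : C -> C) : Prop :=
  holomorphic_on_disc f /\
  (forall z w : C, disc z -> disc w -> f z = f w -> z = w).

Definition disc_image (f : C -> C) (w : C) : Prop :=
  exists z : C, disc z /\ f z = w.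

Definition compact_set (K : C -> Prop) : Prop :=
  forall (I : Type) (U : I -> C -> Prop),
    (forall i : I, open (U i)) ->
    (forall z : C, K z -> exists i : I, U i z) ->
    exists l : list I, forall z : C, K z -> exists i : I, In i l /\ U i z.

(** Maps of the disc are total functions [C -> C], and time is a real number;
    only the values at [z] in the disc and [t >= 0] are constrained. *)
Record nonelliptic_semigroup (phi : R -> C -> C) : Prop := {
  semigroup_holomorphic : forall t : R, 0 <= t -> holomorphic_on_disc (phi t);
  semigroup_self_map :
    forall (t : R) (z : C), 0 <= t -> disc z -> disc (phi t z);
  semigroup_id : forall z : C, disc z -> phi 0 z = z;
  semigroup_add : forall (s t : R) (z : C), 0 <= s -> 0 <= t -> disc z ->
    phi (t + s) z = phi t (phi s z);
  semigroup_continuous :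
    forall (K : C -> Prop), compact_set K -> (forall z : C, K z -> disc z) ->
    forall t0 : R, 0 <= t0 -> forall eps : R, 0 < eps ->
    exists delta : R, 0 < delta /\
      forall t : R, 0 <= t -> Rabs (t - t0) < delta ->
      forall z : C, K z -> Cmod (Cminus (phi t z) (phi t0 z)) < eps;
  semigroup_no_fixed_point :
    forall (t : R) (z : C), 0 < t -> disc z -> phi t z <> z
}.

Definition is_denjoy_wolff_point (phi : R -> C -> C) (tau : C) : Prop :=
  Cmod tau = 1 /\
  forall z : C, disc z ->
    filterlim (fun t : R => phi t z) (Rbar_locally p_infty) (locally tau).

Definition vertical_strip (S : C -> Prop) : Prop :=
  exists a b : R, a < b /\ forall w : C, S w <-> a < Re w < b.

Definition right_half_plane (S : C -> Prop) : Prop :=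
  exists a : R, forall w : C, S w <-> a < Re w.

Definition left_half_plane (S : C -> Prop) : Prop :=
  exists b : R, forall w : C, S w <-> Re w < b.

Definition whole_plane (S : C -> Prop) : Prop := forall w : C, S w.

Definition union_down_translates (D : C -> Prop) (w : C) : Prop :=
  exists (t : R) (u : C), 0 <= t /\ D u /\ w = Cminus u (Cmult Ci (RtoC t)).

Record is_koenigs_function (phi : R -> C -> C) (h : C -> C) : Prop := {
  koenigs_univalent : univalent_on_disc h;
  koenigs_starlike : forall (t : R) (w : C), 0 <= t ->
    disc_image h w -> disc_image h (Cplus w (Cmult Ci (RtoC t)));
  koenigs_conjugation : forall (t : R) (z : C), 0 <= t -> disc z ->
    h (phi t z) = Cplus (h z) (Cmult Ci (RtoC t));
  koenigs_base_space :
    vertical_strip (union_down_translates (disc_image h)) \/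
    right_half_plane (union_down_translates (disc_image h)) \/
    left_half_plane (union_down_translates (disc_image h)) \/
    whole_plane (union_down_translates (disc_image h))
}.

Definition sector (alpha beta : R) (z : C) : Prop :=
  exists r theta : R, 0 < r /\ - alpha < theta < beta /\
    z = (r * cos theta, r * sin theta).

Definition moebius (z w : C) : C :=
  Cdiv (Cminus z w) (Cminus (RtoC 1) (Cmult (Cconj z) w)).

Definition hyp_dist (z w : C) : R :=
  / 2 * ln ((1 + Cmod (moebius z w)) / (1 - Cmod (moebius z w))).

Definition on_diameter (tau w : C) : Prop :=
  exists r : R, -1 < r < 1 /\ w = Cmult (RtoC r) tau.

Definition is_closest_on_diameter (tau z w : C) : Prop :=
  on_diameter tau w /\
  forall w' : C, on_diameter tau w' -> hyp_dist z w <= hyp_dist z w'.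

(** A junk value when there is no closest point; for [z] in the disc and
    [Cmod tau = 1] there is exactly one. *)
Definition proj_diameter (tau z : C) : C :=
  epsilon (inhabits (RtoC 0)) (is_closest_on_diameter tau z).

Definition total_speed (phi : R -> C -> C) (t : R) : R :=
  hyp_dist (RtoC 0) (phi t (RtoC 0)).

Definition orthogonal_speed (phi : R -> C -> C) (tau : C) (t : R) : R :=
  hyp_dist (RtoC 0) (proj_diameter tau (phi t (RtoC 0))).

Definition tangential_speed (phi : R -> C -> C) (tau : C) (t : R) : R :=
  hyp_dist (phi t (RtoC 0)) (proj_diameter tau (phi t (RtoC 0))).

(* Main.v *)
From Stdlib Require Import Reals Lra Psatz.
From Coquelicot Require Import Coquelicot.
Require Import Defs.
Open Scope R_scope.

(** The image of [h] is a rotated translate of the sector with opening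
    [alpha + beta], and the logarithm followed by multiplication by
    [k = PI / (alpha + beta)] straightens it to the right half-plane [H]: the
    composite [Phi = exp (k (log ((h - p) / i) + i (alpha - beta) / 2))] is a
    holomorphic bijection from the disc onto [H].  A holomorphic bijection of
    the disc onto [H] is a Moebius map, and since [phi t 0] tends to [tau] while
    [Phi (phi t 0)] tends to infinity it has the form
    [Phi z = a (tau + z) / (tau - z) + i b] with [a > 0]
    ([halfplane_bijection_normal_form]).

    In the coordinate [w = (tau + z) / (tau - z)] the diameter ending at [tau]
    is the positive half-line, [0] becomes [1], and the point of the half-line
    closest to [w] is [|w|].  Hence, up to bounded errors, the total, orthogonal
    and tangential speeds are [ln (|w|^2 / Re w) / 2], [ln |w| / 2] and
    [ln (|w| / Re w) / 2].  The orbit of [0] is the half-line [u0 + t] in the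
    sector; if [u0 + t = exp (x + i theta)], then [|w|] is comparable to
    [exp (k x)] and [Re w / |w|] to [cos (k (theta + (alpha - beta) / 2))]
    ([speed_estimates]).  Here [exp x] is comparable to [t], and [theta] moves
    monotonically to [0].  When both angles are positive, [0] is interior to
    the angular range and the cosine stays away from zero.  When one angle is
    zero, [0] is an endpoint of the range and the cosine decays like [theta],
    that is, like [1 / t], which produces the additional [ln t / 2].

    The function theory behind the normal form rests on one integral theorem:
    the Goursat subdivision argument on rectangles ([green_goursat]).  In the
    coordinates [z0 + exp (s + i t)] it shows that circular means of a function
    holomorphic in a punctured disc do not depend on the radius
    ([mean_value_le]), which gives the maximum principle with one removable
    point allowed ([maximum_principle]).  This principle, applied to
    [1 / (N - w)], shows that a holomorphic bijection [N] of the disc is proper,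
    and, applied to the quotient of [N] by a Moebius map with the same zero and
    to the inverse of this quotient, that the quotient is a unimodular constant
    ([disc_automorphism]).  Basing the quotient at a point where the derivative
    does not vanish makes both functions continuous there, so it is not needed
    that injective holomorphic functions have nonvanishing derivative. *)

(** * Subdivision of rectangles *)

(** Induction on rectangles by quartering: a property that passes from the four
    quarters to the whole, and holds for every small enough rectangle of the
    same proportions around each point, holds for the whole rectangle.
    Keeping the proportions makes the area comparable to the squared diameter. *)
Lemma rect_induction (P : R -> R -> R -> R -> Prop) (x1 x2 y1 y2 : R) :
  x1 < x2 -> y1 < y2 ->
  (forall a b c d, x1 <= a -> a < b -> b <= x2 -> y1 <= c -> c < d -> d <= y2 ->
     P a ((a + b) / 2) c ((c + d) / 2) -> P ((a + b) / 2) b c ((c + d) / 2) ->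
     P a ((a + b) / 2) ((c + d) / 2) d -> P ((a + b) / 2) b ((c + d) / 2) d ->
     P a b c d) ->
  (forall x y, x1 <= x <= x2 -> y1 <= y <= y2 ->
     exists delta, 0 < delta /\ forall a b c d,
       x1 <= a -> a <= x <= b -> b <= x2 -> y1 <= c -> c <= y <= d -> d <= y2 ->
       0 < b - a < delta -> 0 < d - c < delta ->
       (d - c) * (x2 - x1) = (b - a) * (y2 - y1) -> P a b c d) ->
  P x1 x2 y1 y2.
Proof.
intros Hx Hy Hsplit Hloc.
apply NNPP; intros HP.
set (bad := fun q : (R * R) * (R * R) =>
  x1 <= fst (fst q) /\ fst (fst q) < snd (fst q) /\ snd (fst q) <= x2 /\
  y1 <= fst (snd q) /\ fst (snd q) < snd (snd q) /\ snd (snd q) <= y2 /\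
  (snd (snd q) - fst (snd q)) * (x2 - x1) = (snd (fst q) - fst (fst q)) * (y2 - y1) /\
  ~ P (fst (fst q)) (snd (fst q)) (fst (snd q)) (snd (snd q))).
set (child := fun q q' : (R * R) * (R * R) =>
  fst (fst q) <= fst (fst q') /\ snd (fst q') <= snd (fst q) /\
  snd (fst q') - fst (fst q') = (snd (fst q) - fst (fst q)) / 2 /\
  fst (snd q) <= fst (snd q') /\ snd (snd q') <= snd (snd q) /\
  snd (snd q') - fst (snd q') = (snd (snd q) - fst (snd q)) / 2).
assert (Hstep : forall q : {q | bad q}, exists q' : {q | bad q},
  child (proj1_sig q) (proj1_sig q')).
{ intros [[[a b] [c d]] (H1 & H2 & H3 & H4 & H5 & H6 & H7 & H8)]; simpl in *.
  apply NNPP; intros Hno.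
  apply H8; apply Hsplit; try assumption; apply NNPP; intros Hn; apply Hno.
  1: assert (Hb : bad ((a, (a + b) / 2), (c, (c + d) / 2))).
  3: assert (Hb : bad (((a + b) / 2, b), (c, (c + d) / 2))).
  5: assert (Hb : bad ((a, (a + b) / 2), ((c + d) / 2, d))).
  7: assert (Hb : bad (((a + b) / 2, b), ((c + d) / 2, d))).
  1, 3, 5, 7: unfold bad; simpl; do 6 (split; [lra|]); split; [nra|assumption].
  all: exists (exist _ _ Hb); unfold child; simpl; repeat split; lra. }
destruct (choice _ Hstep) as [next Hnext].
assert (H0 : bad ((x1, x2), (y1, y2))).
{ unfold bad; simpl; do 6 (split; [lra|]); split; [ring|assumption]. }
set (s := fix s (n : nat) : {q | bad q} :=
  match n with O => exist _ _ H0 | S n => next (s n) end).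
set (a := fun n => fst (fst (proj1_sig (s n)))).
set (b := fun n => snd (fst (proj1_sig (s n)))).
set (c := fun n => fst (snd (proj1_sig (s n)))).
set (d := fun n => snd (snd (proj1_sig (s n)))).
assert (Hbad : forall n, x1 <= a n /\ a n < b n /\ b n <= x2 /\
  y1 <= c n /\ c n < d n /\ d n <= y2 /\
  (d n - c n) * (x2 - x1) = (b n - a n) * (y2 - y1) /\ ~ P (a n) (b n) (c n) (d n)).
{ intros n; exact (proj2_sig (s n)). }
assert (Hch : forall n, a n <= a (S n) /\ b (S n) <= b n /\
  b (S n) - a (S n) = (b n - a n) / 2 /\ c n <= c (S n) /\ d (S n) <= d n /\
  d (S n) - c (S n) = (d n - c n) / 2).
{ intros n; exact (Hnext (s n)). }
assert (Hlen : forall n, b n - a n = (x2 - x1) / 2 ^ n /\ d n - c n = (y2 - y1) / 2 ^ n).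
{ induction n as [|n IH]; [unfold a, b, c, d; simpl; lra|].
  destruct (Hch n) as (_ & _ & E1 & _ & _ & E2), IH as [I1 I2].
  rewrite E1, E2, I1, I2; simpl; split; field; apply pow_nonzero; lra. }
assert (Hnest : forall u v : nat -> R, (forall n, u n < v n) ->
  (forall n, u n <= u (S n)) -> (forall n, v (S n) <= v n) ->
  exists x, forall n, u n <= x <= v n).
{ intros u v Huv Hu Hv.
  assert (Hu' : forall n m, (n <= m)%nat -> u n <= u m).
  { intros n m Hnm; induction Hnm; [lra|specialize (Hu m); lra]. }
  assert (Hv' : forall n m, (n <= m)%nat -> v m <= v n).
  { intros n m Hnm; induction Hnm; [lra|specialize (Hv m); lra]. }
  assert (Hmn : forall n m, u n <= v m).
  { intros n m; specialize (Huv (Nat.max n m)).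
    pose proof (Hu' n (Nat.max n m) (Nat.le_max_l _ _)).
    pose proof (Hv' m (Nat.max n m) (Nat.le_max_r _ _)); lra. }
  destruct (completeness (fun x => exists n, x = u n)) as [x [Hub Hlub]].
  - exists (v O); intros y [n ->]; apply Hmn.
  - exists (u O); now exists O.
  - exists x; intros n; split; [apply Hub; now exists n|].
    apply Hlub; intros y [m ->]; apply Hmn. }
destruct (Hnest a b) as [x Hxn]; try (intros n; specialize (Hbad n); specialize (Hch n); tauto).
destruct (Hnest c d) as [y Hyn]; try (intros n; specialize (Hbad n); specialize (Hch n); tauto).
destruct (Hloc x y) as (delta & Hdelta & Hd).
{ specialize (Hxn O); specialize (Hbad O); lra. }
{ specialize (Hyn O); specialize (Hbad O); lra. }
set (L := (x2 - x1) + (y2 - y1)).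
destruct (pow_lt_1_zero (/ 2)) with (y := delta / L) as [N HN].
{ rewrite Rabs_pos_eq; lra. }
{ apply Rdiv_lt_0_compat; unfold L; lra. }
specialize (HN N (Nat.le_refl _)).
rewrite Rabs_pos_eq in HN by (apply pow_le; lra).
rewrite pow_inv in HN.
assert (Hsmall : / 2 ^ N * L < delta).
{ apply Rmult_lt_compat_r with (r := L) in HN; [|unfold L; lra].
  unfold Rdiv in HN; rewrite Rmult_assoc, Rinv_l, Rmult_1_r in HN; [assumption|unfold L; lra]. }
assert (Hinv : 0 < / 2 ^ N) by (apply Rinv_0_lt_compat, pow_lt; lra).
destruct (Hbad N) as (B1 & B2 & B3 & B4 & B5 & B6 & B7 & B8), (Hlen N) as [L1 L2].
apply B8, Hd; try assumption; try apply Hxn; try apply Hyn;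
  unfold Rdiv in *; unfold L in *; nra.
Qed.

(** * Integrals of closed forms around rectangles *)

Lemma differentiable_pt_lim_continuous_x f x y lx ly :
  differentiable_pt_lim f x y lx ly -> continuous (fun u => f u y) x.
Proof.
intros H; apply (ex_derive_continuous (V := R_NormedModule)).
exists (lx * 1 + ly * 0); apply is_derive_Reals.
apply derivable_pt_lim_comp_2d; [assumption|apply derivable_pt_lim_id|apply derivable_pt_lim_const].
Qed.

Lemma differentiable_pt_lim_continuous_y f x y lx ly :
  differentiable_pt_lim f x y lx ly -> continuous (fun v => f x v) y.
Proof.
intros H; apply (ex_derive_continuous (V := R_NormedModule)).
exists (lx * 0 + ly * 1); apply is_derive_Reals.
apply (derivable_pt_lim_comp_2d f (fun _ => x) (fun v => v));
  [assumption|apply derivable_pt_lim_const|apply derivable_pt_lim_id].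
Qed.

Lemma RInt_diff_approx (f g : R -> R) (a b l M : R) :
  a <= b -> ex_RInt f a b -> ex_RInt g a b ->
  (forall x, a <= x <= b -> Rabs (f x - g x - l) <= M) ->
  Rabs (RInt f a b - RInt g a b - (b - a) * l) <= (b - a) * M.
Proof.
intros Hab Hf Hg H.
assert (Hl : ex_RInt (fun _ : R => l) a b) by apply ex_RInt_const.
assert (Hfg : ex_RInt (fun x => minus (f x) (g x)) a b) by now apply @ex_RInt_minus.
replace (RInt f a b - RInt g a b - (b - a) * l)
  with (RInt (fun x => minus (minus (f x) (g x)) l) a b).
- apply abs_RInt_le_const; [assumption|now apply @ex_RInt_minus|exact H].
- rewrite (RInt_minus (V := R_CompleteNormedModule)) by assumption.
  rewrite (RInt_minus (V := R_CompleteNormedModule)) by assumption.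
  rewrite RInt_const; reflexivity.
Qed.

(** The integral of [P dx + Q dy] around a rectangle vanishes when [P] and [Q]
    are differentiable with [dP/dy = dQ/dx] at each point.  Continuity of the
    partial derivatives is not assumed. *)
Lemma green_goursat (P Q : R -> R -> R) (x1 x2 y1 y2 : R) :
  x1 < x2 -> y1 < y2 ->
  (forall x y, x1 <= x <= x2 -> y1 <= y <= y2 -> exists px py qy,
     differentiable_pt_lim P x y px py /\ differentiable_pt_lim Q x y py qy) ->
  RInt (fun x => P x y1) x1 x2 + RInt (fun y => Q x2 y) y1 y2
  = RInt (fun x => P x y2) x1 x2 + RInt (fun y => Q x1 y) y1 y2.
Proof.
intros Hx Hy HPQ.
assert (IP : forall a b y, x1 <= a -> a < b -> b <= x2 -> y1 <= y <= y2 ->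
  ex_RInt (fun x => P x y) a b).
{ intros a b y H1 H2 H3 Hyy; apply (ex_RInt_continuous (V := R_CompleteNormedModule)).
  rewrite Rmin_left, Rmax_right by lra; intros x Hxx.
  destruct (HPQ x y) as (px & py & qy & HP & HQ); [lra|lra|].
  eapply differentiable_pt_lim_continuous_x; exact HP. }
assert (IQ : forall a b x, y1 <= a -> a < b -> b <= y2 -> x1 <= x <= x2 ->
  ex_RInt (fun y => Q x y) a b).
{ intros a b x H1 H2 H3 Hxx; apply (ex_RInt_continuous (V := R_CompleteNormedModule)).
  rewrite Rmin_left, Rmax_right by lra; intros y Hyy.
  destruct (HPQ x y) as (px & py & qy & HP & HQ); [lra|lra|].
  eapply differentiable_pt_lim_continuous_y; exact HQ. }
set (J := fun a b c d => RInt (fun x => P x c) a b - RInt (fun x => P x d) a b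
  + (RInt (fun y => Q b y) c d - RInt (fun y => Q a y) c d)).
enough (HJ : forall eps, 0 < eps -> Rabs (J x1 x2 y1 y2) <= eps * ((x2 - x1) * (y2 - y1))).
{ enough (J x1 x2 y1 y2 = 0) by (unfold J in *; lra).
  apply NNPP; intros HJ0; apply Rabs_pos_lt in HJ0.
  assert (HA : 0 < (x2 - x1) * (y2 - y1)) by nra.
  specialize (HJ (Rabs (J x1 x2 y1 y2) / 2 / ((x2 - x1) * (y2 - y1)))).
  assert (E : Rabs (J x1 x2 y1 y2) / 2 / ((x2 - x1) * (y2 - y1)) * ((x2 - x1) * (y2 - y1))
    = Rabs (J x1 x2 y1 y2) / 2) by (field; lra).
  rewrite E in HJ; enough (0 < Rabs (J x1 x2 y1 y2) / 2 / ((x2 - x1) * (y2 - y1))) by lra.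
  apply Rdiv_lt_0_compat; lra. }
intros eps Heps.
apply (rect_induction (fun a b c d => Rabs (J a b c d) <= eps * ((b - a) * (d - c)))); try assumption.
- intros a b c d A1 A2 A3 A4 A5 A6.
  set (m := (a + b) / 2); set (n := (c + d) / 2).
  assert (Hm : m = (a + b) / 2) by reflexivity; assert (Hn : n = (c + d) / 2) by reflexivity.
  assert (E : J a b c d = J a m c n + J m b c n + (J a m n d + J m b n d)).
  { assert (CP : forall y, y1 <= y <= y2 ->
      RInt (fun x => P x y) a b = RInt (fun x => P x y) a m + RInt (fun x => P x y) m b).
    { intros y Hyy; symmetry; apply (RInt_Chasles (V := R_CompleteNormedModule)); apply IP; lra. }
    assert (CQ : forall x, x1 <= x <= x2 ->
      RInt (fun y => Q x y) c d = RInt (fun y => Q x y) c n + RInt (fun y => Q x y) n d).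
    { intros x Hxx; symmetry; apply (RInt_Chasles (V := R_CompleteNormedModule)); apply IQ; lra. }
    unfold J; rewrite (CP c), (CP d), (CQ a), (CQ b) by lra; ring. }
  intros H1 H2 H3 H4; rewrite E.
  pose proof (Rabs_triang (J a m c n + J m b c n) (J a m n d + J m b n d)).
  pose proof (Rabs_triang (J a m c n) (J m b c n)).
  pose proof (Rabs_triang (J a m n d) (J m b n d)).
  replace (eps * ((b - a) * (d - c))) with
    (eps * ((m - a) * (n - c)) + eps * ((b - m) * (n - c)) +
     (eps * ((m - a) * (d - n)) + eps * ((b - m) * (d - n)))) by (rewrite Hm, Hn; field).
  lra.
- intros x y Hxx Hyy.
  destruct (HPQ x y Hxx Hyy) as (px & py & qy & HP & HQ).
  set (k := (y2 - y1) / (x2 - x1)).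
  assert (Hk : 0 < k) by (apply Rdiv_lt_0_compat; lra).
  (* the rectangles have sides l and k l, so that the square of (1 + k) l is
     (1 + k)^2 / k times their area *)
  set (e := eps * k / (2 * (1 + k) ^ 2)).
  assert (He : 0 < e) by (apply Rdiv_lt_0_compat; nra).
  destruct (HP (mkposreal e He)) as [d1 Hd1], (HQ (mkposreal e He)) as [d2 Hd2]; simpl in *.
  exists (Rmin d1 d2); split; [apply Rmin_pos; apply cond_pos|].
  intros a b c d A1 A2 A3 A4 A5 A6 A7 A8 A9.
  pose proof (Rmin_l d1 d2); pose proof (Rmin_r d1 d2).
  assert (Hdk : d - c = k * (b - a)).
  { unfold k; apply Rmult_eq_reg_r with (x2 - x1); [|lra]; rewrite A9; field; lra. }
  set (m := (b - a) + (d - c)).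
  assert (Hmax : forall u v, a <= u <= b -> c <= v <= d ->
    Rabs (u - x) < Rmin d1 d2 /\ Rabs (v - y) < Rmin d1 d2 /\
    e * Rmax (Rabs (u - x)) (Rabs (v - y)) <= e * m).
  { intros u v Hu Hv.
    assert (Rabs (u - x) <= b - a) by (apply Rabs_le; lra).
    assert (Rabs (v - y) <= d - c) by (apply Rabs_le; lra).
    repeat split; try lra; apply Rmult_le_compat_l; [lra|].
    apply Rmax_lub; unfold m; lra. }
  assert (E1 : Rabs (RInt (fun x => P x c) a b - RInt (fun x => P x d) a b
    - (b - a) * (py * (c - d))) <= (b - a) * (2 * (e * m))).
  { apply RInt_diff_approx; [lra|apply IP; lra|apply IP; lra|].
    intros u Hu.
    destruct (Hmax u c) as (M1 & M2 & M3); [lra|lra|].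
    destruct (Hmax u d) as (M4 & M5 & M6); [lra|lra|].
    assert (F1 := Hd1 u c ltac:(lra) ltac:(lra)).
    assert (F2 := Hd1 u d ltac:(lra) ltac:(lra)).
    apply Rabs_le; revert F1 F2; unfold Rabs at 1 4; repeat destruct Rcase_abs; lra. }
  assert (E2 : Rabs (RInt (fun y => Q b y) c d - RInt (fun y => Q a y) c d
    - (d - c) * (py * (b - a))) <= (d - c) * (2 * (e * m))).
  { apply RInt_diff_approx; [lra|apply IQ; lra|apply IQ; lra|].
    intros v Hv.
    destruct (Hmax a v) as (M1 & M2 & M3); [lra|lra|].
    destruct (Hmax b v) as (M4 & M5 & M6); [lra|lra|].
    assert (F1 := Hd2 a v ltac:(lra) ltac:(lra)).
    assert (F2 := Hd2 b v ltac:(lra) ltac:(lra)).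
    apply Rabs_le; revert F1 F2; unfold Rabs at 1 4; repeat destruct Rcase_abs; lra. }
  assert (E3 : eps * ((b - a) * (d - c)) = (b - a) * (2 * (e * m)) + (d - c) * (2 * (e * m))).
  { unfold m, e; rewrite Hdk; field; lra. }
  rewrite E3.
  assert (EJ : J a b c d =
   (RInt (fun x => P x c) a b - RInt (fun x => P x d) a b - (b - a) * (py * (c - d)))
   + (RInt (fun y => Q b y) c d - RInt (fun y => Q a y) c d - (d - c) * (py * (b - a))))
   by (unfold J; ring).
  rewrite EJ; eapply Rle_trans; [apply Rabs_triang|lra].
Qed.

(** * Complex continuity and differentiability *)

(** Continuity at a point, for the modulus. *)
Definition ccont (f : C -> C) (z : C) : Prop :=
  forall eps, 0 < eps -> exists delta, 0 < delta /\
    forall w, Cmod (w - z) < delta -> Cmod (f w - f z) < eps.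

(** [cder f z l]: the complex derivative of [f] at [z] is [l], in
    Caratheodory's form.  The slope function [q] is continuous at [z] only; it
    also serves as the quotient of [f] by [w - z] when [f z = 0]. *)
Definition cder (f : C -> C) (z l : C) : Prop :=
  exists q : C -> C, ccont q z /\ q z = l /\
    forall w, f w = (f z + q w * (w - z))%C.

Lemma Cmod_pos (z : C) : z <> 0 -> 0 < Cmod z.
Proof. apply Cmod_gt_0. Qed.

Lemma Cneq_0 (z : C) : 0 < Cmod z -> z <> 0.
Proof. apply Cmod_gt_0. Qed.

Lemma Cmod_minus_sym (z w : C) : Cmod (z - w) = Cmod (w - z).
Proof. rewrite <- Cmod_opp; f_equal; ring. Qed.

Lemma Cmod_triangle3 x y z : Cmod (x - z) <= Cmod (x - y) + Cmod (y - z).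
Proof. replace (x - z)%C with ((x - y) + (y - z))%C by ring; apply Cmod_triangle. Qed.

Lemma Cmod_rev_triangle x y : Cmod x - Cmod y <= Cmod (x - y).
Proof.
replace x with ((x - y) + y)%C at 1 by ring.
pose proof (Cmod_triangle (x - y) y); lra.
Qed.

Lemma Cmod_minus_pos (z w : C) : z <> w -> 0 < Cmod (z - w).
Proof.
intros H; apply Cmod_pos; intros E; apply H.
replace z with ((z - w) + w)%C by ring; rewrite E; ring.
Qed.

Lemma Cminus_neq_0 (z w : C) : z <> w -> (z - w)%C <> 0.
Proof. intros H; apply Cneq_0, Cmod_minus_pos, H. Qed.

Lemma ccont_ext_loc f g z d :
  0 < d -> (forall w, Cmod (w - z) < d -> f w = g w) -> ccont f z -> ccont g z.
Proof.
intros Hd Hfg Hf eps Heps; destruct (Hf eps Heps) as (e & He & H).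
exists (Rmin d e); split; [now apply Rmin_pos|intros w Hw].
pose proof (Rmin_l d e); pose proof (Rmin_r d e).
rewrite <- !Hfg; [apply H; lra| |lra].
replace (z - z)%C with (RtoC 0) by ring; rewrite Cmod_0; assumption.
Qed.

Lemma ccont_const a z : ccont (fun _ => a) z.
Proof.
intros eps Heps; exists 1; split; [lra|intros w _].
replace (a - a)%C with (RtoC 0) by ring; rewrite Cmod_0; assumption.
Qed.

Lemma ccont_id z : ccont (fun w => w) z.
Proof. intros eps Heps; now exists eps. Qed.

Lemma ccont_plus f g z : ccont f z -> ccont g z -> ccont (fun w => (f w + g w)%C) z.
Proof.
intros Hf Hg eps Heps.
destruct (Hf (eps / 2)) as (d1 & D1 & H1); [lra|].
destruct (Hg (eps / 2)) as (d2 & D2 & H2); [lra|].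
exists (Rmin d1 d2); split; [now apply Rmin_pos|intros w Hw].
pose proof (Rmin_l d1 d2); pose proof (Rmin_r d1 d2).
specialize (H1 w ltac:(lra)); specialize (H2 w ltac:(lra)).
replace (f w + g w - (f z + g z))%C with ((f w - f z) + (g w - g z))%C by ring.
eapply Rle_lt_trans; [apply Cmod_triangle|lra].
Qed.

Lemma ccont_mult f g z : ccont f z -> ccont g z -> ccont (fun w => (f w * g w)%C) z.
Proof.
intros Hf Hg eps Heps.
pose proof (Cmod_ge_0 (f z)) as F0; pose proof (Cmod_ge_0 (g z)) as G0.
set (e1 := eps / (2 * (Cmod (g z) + 1))).
set (e2 := eps / (2 * (Cmod (f z) + 1))).
assert (E1 : 0 < e1) by (apply Rdiv_lt_0_compat; lra).
assert (E2 : 0 < e2) by (apply Rdiv_lt_0_compat; lra).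
assert (E1' : e1 * (Cmod (g z) + 1) = eps / 2) by (unfold e1; field; lra).
assert (E2' : e2 * (Cmod (f z) + 1) = eps / 2) by (unfold e2; field; lra).
destruct (Hf e1 E1) as (d1 & D1 & H1).
destruct (Hg (Rmin 1 e2)) as (d2 & D2 & H2); [apply Rmin_pos; lra|].
exists (Rmin d1 d2); split; [now apply Rmin_pos|intros w Hw].
pose proof (Rmin_l d1 d2); pose proof (Rmin_r d1 d2).
pose proof (Rmin_l 1 e2); pose proof (Rmin_r 1 e2).
specialize (H1 w ltac:(lra)); specialize (H2 w ltac:(lra)).
replace (f w * g w - f z * g z)%C with ((f w - f z) * g w + f z * (g w - g z))%C by ring.
eapply Rle_lt_trans; [apply Cmod_triangle|rewrite !Cmod_mult].
pose proof (Cmod_rev_triangle (g w) (g z)).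
pose proof (Cmod_ge_0 (f w - f z)); pose proof (Cmod_ge_0 (g w - g z)).
pose proof (Cmod_ge_0 (g w)).
assert (Cmod (f w - f z) * Cmod (g w) <= eps / 2).
{ rewrite <- E1'; apply Rmult_le_compat; lra. }
assert (Cmod (f z) * Cmod (g w - g z) <= Cmod (f z) * e2).
{ apply Rmult_le_compat_l; lra. }
nra.
Qed.

Lemma ccont_comp f g z : ccont f z -> ccont g (f z) -> ccont (fun w => g (f w)) z.
Proof.
intros Hf Hg eps Heps.
destruct (Hg eps Heps) as (d & D & H), (Hf d D) as (d' & D' & H').
exists d'; split; auto.
Qed.

Lemma Cmod_lower z w d : Cmod (w - z) < d -> Cmod z - d < Cmod w.
Proof.
intros H; pose proof (Cmod_rev_triangle z w) as H'; rewrite Cmod_minus_sym in H'; lra.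
Qed.

Lemma ccont_inv (z : C) : z <> 0 -> ccont Cinv z.
Proof.
intros Hz eps Heps; assert (Hz' := Cmod_pos z Hz).
exists (Rmin (Cmod z / 2) (eps * (Cmod z * Cmod z / 2))).
assert (0 < eps * (Cmod z * Cmod z / 2)).
{ apply Rmult_lt_0_compat; nra. }
split; [apply Rmin_pos; lra|intros w Hw].
pose proof (Rmin_l (Cmod z / 2) (eps * (Cmod z * Cmod z / 2))).
pose proof (Rmin_r (Cmod z / 2) (eps * (Cmod z * Cmod z / 2))).
assert (Hw' := Cmod_lower z w (Cmod z / 2) ltac:(lra)).
assert (w <> 0) by (apply Cneq_0; lra).
replace (/ w - / z)%C with ((z - w) / (w * z))%C by (field; auto).
rewrite Cmod_div by (apply Cneq_0; rewrite Cmod_mult; nra).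
rewrite Cmod_mult, Cmod_minus_sym; apply Rlt_div_l; [nra|].
eapply Rlt_le_trans; [exact (Rlt_le_trans _ _ _ Hw H1)|].
apply Rmult_le_compat_l; nra.
Qed.

Lemma cder_cont f z l : cder f z l -> ccont f z.
Proof.
intros (q & Hq & _ & H).
apply ccont_ext_loc with (fun w => (f z + q w * (w + - z))%C) 1; [lra|now intros; rewrite (H w)|].
apply ccont_plus; [apply ccont_const|].
apply ccont_mult; [assumption|].
apply ccont_plus; [apply ccont_id|apply ccont_const].
Qed.

(** The slope function is only needed near the point. *)
Lemma cder_intro f z l q d : 0 < d -> ccont q z -> q z = l ->
  (forall w, Cmod (w - z) < d -> f w = (f z + q w * (w - z))%C) -> cder f z l.
Proof.
intros Hd Hq Hl H.
set (q' := fun w => if excluded_middle_informative (Cmod (w - z) < d) then q w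
  else ((f w - f z) / (w - z))%C).
assert (Hq' : forall w, Cmod (w - z) < d -> q w = q' w).
{ intros w Hw; unfold q'; destruct excluded_middle_informative; tauto. }
assert (Hz : Cmod (z - z) < d).
{ replace (z - z)%C with (RtoC 0) by ring; rewrite Cmod_0; assumption. }
exists q'; split; [now apply ccont_ext_loc with q d|split; [now rewrite <- Hq'|]].
intros w; unfold q'; destruct excluded_middle_informative as [Hw|Hw]; [now apply H|].
field; apply Cneq_0; lra.
Qed.

Lemma cder_ext_loc f g z l d : 0 < d -> (forall w, Cmod (w - z) < d -> f w = g w) ->
  cder f z l -> cder g z l.
Proof.
intros Hd Hfg (q & H1 & H2 & H3).
apply cder_intro with q d; try assumption.
intros w Hw; rewrite <- !Hfg; auto.
replace (z - z)%C with (RtoC 0) by ring; rewrite Cmod_0; assumption.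
Qed.

Lemma cder_const a z : cder (fun _ => a) z 0.
Proof.
exists (fun _ => RtoC 0); split; [apply ccont_const|split; [reflexivity|intros; ring]].
Qed.

Lemma cder_id z : cder (fun w => w) z 1.
Proof.
exists (fun _ => RtoC 1); split; [apply ccont_const|split; [reflexivity|intros; ring]].
Qed.

Lemma cder_plus f g z l m : cder f z l -> cder g z m ->
  cder (fun w => (f w + g w)%C) z (l + m).
Proof.
intros (q & H1 & H2 & H3) (q' & H1' & H2' & H3').
exists (fun w => (q w + q' w)%C); split; [now apply ccont_plus|].
split; [now rewrite H2, H2'|intros w; rewrite (H3 w), (H3' w); ring].
Qed.

Lemma cder_mult f g z l m : cder f z l -> cder g z m ->
  cder (fun w => (f w * g w)%C) z (l * g z + f z * m).
Proof.
intros (q & H1 & H2 & H3) (q' & H1' & H2' & H3').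
exists (fun w => (q w * g w + f z * q' w)%C); split.
- apply ccont_plus; apply ccont_mult; auto using ccont_const.
  apply cder_cont with m; now exists q'.
- split; [now rewrite H2, H2'|intros w; rewrite (H3 w), (H3' w); ring].
Qed.

Lemma cder_comp f g z l m : cder f z l -> cder g (f z) m ->
  cder (fun w => g (f w)) z (m * l).
Proof.
intros Hf (q' & H1' & H2' & H3').
assert (Hc := cder_cont _ _ _ Hf); destruct Hf as (q & H1 & H2 & H3).
exists (fun w => (q' (f w) * q w)%C); split.
- apply ccont_mult; [now apply ccont_comp|assumption].
- split; [now rewrite H2, H2'|intros w; rewrite (H3' (f w))].
  assert (E : (f w - f z = q w * (w - z))%C) by (rewrite (H3 w); ring).
  rewrite E; ring.
Qed.

Lemma cder_inv (z : C) : z <> 0 -> cder Cinv z (- / (z * z))%C.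
Proof.
intros Hz; assert (Hz' := Cmod_pos z Hz).
apply cder_intro with (fun w => (- / z * / w)%C) (Cmod z); [assumption| | |].
- apply ccont_mult; [apply ccont_const|now apply ccont_inv].
- field; assumption.
- intros w Hw; assert (w <> 0).
  { apply Cneq_0; apply Cmod_lower in Hw; lra. }
  field; auto.
Qed.

Lemma cder_of_approx f (z l : C) :
  (forall eps, 0 < eps -> exists delta, 0 < delta /\ forall w, Cmod (w - z) < delta ->
     Cmod (f w - f z - l * (w - z)) <= eps * Cmod (w - z)) -> cder f z l.
Proof.
intros H.
set (q := fun w => if excluded_middle_informative (w = z) then l
  else ((f w - f z) / (w - z))%C).
assert (Hqz : q z = l) by (unfold q; destruct excluded_middle_informative; tauto).
exists q; split; [|split; [assumption|]].
2:{ intros w; unfold q; destruct excluded_middle_informative as [->|Hw]; [ring|].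
  field; now apply Cminus_neq_0. }
intros eps Heps.
destruct (H (eps / 2)) as (d & Hd & Hw'); [lra|].
exists d; split; [assumption|intros w Hw]; rewrite Hqz.
unfold q; destruct excluded_middle_informative as [->|Hwz].
{ replace (l - l)%C with (RtoC 0) by ring; rewrite Cmod_0; assumption. }
assert (Hp := Cmod_minus_pos w z Hwz).
replace ((f w - f z) / (w - z) - l)%C with ((f w - f z - l * (w - z)) / (w - z))%C
  by (field; now apply Cminus_neq_0).
rewrite Cmod_div by now apply Cminus_neq_0.
apply Rlt_div_l; [assumption|].
eapply Rle_lt_trans; [exact (Hw' w Hw)|nra].
Qed.

Lemma cder_approx f (z l : C) : cder f z l ->
  forall eps, 0 < eps -> exists delta, 0 < delta /\ forall w, Cmod (w - z) < delta ->
     Cmod (f w - f z - l * (w - z)) <= eps * Cmod (w - z).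
Proof.
intros (q & Hq & <- & H) eps Heps.
destruct (Hq eps Heps) as (d & Hd & Hw); exists d; split; [assumption|intros w Hwd].
rewrite (H w); replace (f z + q w * (w - z) - f z - q z * (w - z))%C
  with ((q w - q z) * (w - z))%C by ring.
rewrite Cmod_mult; apply Rmult_le_compat_r; [apply Cmod_ge_0|left; auto].
Qed.

Lemma cder_of_ex_derive (f : C -> C) (z : C) :
  @ex_derive C_AbsRing C_NormedModule f z -> exists l, cder f z l.
Proof.
intros [l [_ H]]; exists l.
assert (H' := H z (fun P HP => HP)); clear H.
apply cder_of_approx; intros eps Heps.
destruct (H' (mkposreal eps Heps)) as [d Hd].
exists d; split; [apply cond_pos|intros w Hw].
rewrite (Cmult_comm l); exact (Hd w Hw).
Qed.

(** * The exponential and the mean value property *)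

(** The complex exponential. *)
Definition cexp (z : C) : C := (exp (fst z) * cos (snd z), exp (fst z) * sin (snd z)).

Lemma cexp_plus z w : cexp (z + w) = (cexp z * cexp w)%C.
Proof.
unfold cexp, Cmult, Cplus; simpl; rewrite exp_plus, cos_plus, sin_plus; f_equal; ring.
Qed.

Lemma Cmod_polar r t : Cmod (r * cos t, r * sin t) = Rabs r.
Proof.
unfold Cmod; simpl.
replace (_ + _) with (Rsqr r).
- apply sqrt_Rsqr_abs.
- pose proof (sin2_cos2 t); unfold Rsqr in *; nra.
Qed.

Lemma Cmod_cexp z : Cmod (cexp z) = exp (fst z).
Proof.
unfold cexp; rewrite Cmod_polar; apply Rabs_pos_eq; left; apply exp_pos.
Qed.

Lemma cexp_neq_0 z : cexp z <> 0.
Proof. apply Cneq_0; rewrite Cmod_cexp; apply exp_pos. Qed.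

Lemma snd_le_Cmod (z : C) : Rabs (snd z) <= Cmod z.
Proof. eapply Rle_trans; [apply Rmax_r|apply Rmax_Cmod]. Qed.

Lemma fst_le_Cmod (z : C) : Rabs (fst z) <= Cmod z.
Proof. eapply Rle_trans; [apply Rmax_l|apply Rmax_Cmod]. Qed.

Lemma Cmod_le_abs (z : C) : Cmod z <= Rabs (fst z) + Rabs (snd z).
Proof.
replace z with ((RtoC (fst z)) + Ci * RtoC (snd z))%C at 1.
- eapply Rle_trans; [apply Cmod_triangle|].
  rewrite Cmod_mult, Cmod_Ci, !Cmod_R; lra.
- destruct z; unfold Cplus, Cmult, Ci, RtoC; simpl; f_equal; ring.
Qed.

Lemma derivable_pt_lim_approx f x l : derivable_pt_lim f x l ->
  forall eps, 0 < eps -> exists delta, 0 < delta /\ forall h, Rabs h < delta ->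
    Rabs (f (x + h) - f x - l * h) <= eps * Rabs h.
Proof.
intros H eps Heps; destruct (H eps Heps) as [d Hd].
exists d; split; [apply cond_pos|intros h Hh].
destruct (Req_dec h 0) as [->|Hh0].
- rewrite Rplus_0_r; replace (f x - f x - l * 0) with 0 by ring; rewrite Rabs_R0; lra.
- specialize (Hd h Hh0 Hh).
  replace (f (x + h) - f x - l * h) with (((f (x + h) - f x) / h - l) * h) by (field; assumption).
  rewrite Rabs_mult; apply Rmult_le_compat_r; [apply Rabs_pos|lra].
Qed.

Lemma cder_cexp_0 : cder cexp 0 1.
Proof.
apply cder_of_approx; intros eps Heps.
set (e := Rmin 1 (eps / 10)).
assert (He : 0 < e) by (apply Rmin_pos; lra).
assert (He1 : e <= 1) by apply Rmin_l.
assert (He2 : e <= eps / 10) by apply Rmin_r.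
destruct (derivable_pt_lim_approx _ _ _ (derivable_pt_lim_exp 0) e He) as (d1 & D1 & H1).
destruct (derivable_pt_lim_approx _ _ _ (derivable_pt_lim_sin 0) e He) as (d2 & D2 & H2).
destruct (derivable_pt_lim_approx _ _ _ (derivable_pt_lim_cos 0) e He) as (d3 & D3 & H3).
set (d := Rmin (Rmin d1 d2) (Rmin d3 (e / 2))).
assert (Hd : d <= d1 /\ d <= d2 /\ d <= d3 /\ d <= e / 2).
{ unfold d; pose proof (Rmin_l (Rmin d1 d2) (Rmin d3 (e / 2))).
  pose proof (Rmin_r (Rmin d1 d2) (Rmin d3 (e / 2))).
  pose proof (Rmin_l d1 d2); pose proof (Rmin_r d1 d2).
  pose proof (Rmin_l d3 (e / 2)); pose proof (Rmin_r d3 (e / 2)); lra. }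
exists d; split; [repeat apply Rmin_pos; lra|intros w Hw].
replace (w - 0)%C with w in * by ring.
destruct w as [x y].
pose proof (fst_le_Cmod (x, y)) as Hx; pose proof (snd_le_Cmod (x, y)) as Hy; simpl in Hx, Hy.
set (m := Cmod (x, y)) in *.
specialize (H1 x ltac:(lra)); specialize (H2 y ltac:(lra)); specialize (H3 y ltac:(lra)).
rewrite Rplus_0_l in *; rewrite exp_0, sin_0, cos_0 in *.
eapply Rle_trans; [apply Cmod_le_abs|].
unfold cexp; simpl; rewrite exp_0, sin_0, cos_0.
assert (m0 : 0 <= m) by apply Cmod_ge_0.
assert (G1 : Rabs (exp x - 1) <= 2 * e).
{ replace (exp x - 1) with ((exp x - 1 - 1 * x) + x) by ring.
  eapply Rle_trans; [apply Rabs_triang|]; pose proof (Rabs_pos x); nra. }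
assert (G2 : 0 < exp x <= 3).
{ split; [apply exp_pos|]; apply Rabs_le_between in G1; lra. }
assert (G3 : e * Rabs x <= e * m) by (apply Rmult_le_compat_l; lra).
assert (G4 : e * Rabs y <= e * m) by (apply Rmult_le_compat_l; lra).
match goal with |- Rabs ?u + Rabs ?v <= _ =>
  replace u with (exp x * (cos y - 1 - - 0 * y) + (exp x - 1 - 1 * x)) by ring;
  replace v with (exp x * (sin y - 0 - 1 * y) + (exp x - 1) * y) by ring end.
assert (K1 : Rabs (exp x * (cos y - 1 - - 0 * y)) <= 3 * (e * m)).
{ rewrite Rabs_mult, (Rabs_pos_eq (exp x)) by lra.
  apply Rmult_le_compat; try lra; apply Rabs_pos. }
assert (K2 : Rabs (exp x * (sin y - 0 - 1 * y)) <= 3 * (e * m)).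
{ rewrite Rabs_mult, (Rabs_pos_eq (exp x)) by lra.
  apply Rmult_le_compat; try lra; apply Rabs_pos. }
assert (K3 : Rabs ((exp x - 1) * y) <= 2 * e * m).
{ rewrite Rabs_mult; apply Rmult_le_compat; try lra; apply Rabs_pos. }
eapply Rle_trans; [apply Rplus_le_compat; apply Rabs_triang|].
assert (e * m <= eps / 10 * m) by (apply Rmult_le_compat_r; lra).
assert (0 <= eps * m) by (apply Rmult_le_pos; lra).
lra.
Qed.

Lemma cder_cexp z : cder cexp z (cexp z).
Proof.
apply cder_ext_loc with (fun w => (cexp z * cexp (w + - z))%C) 1; [lra| |].
{ intros w _; rewrite <- cexp_plus; f_equal; ring. }
assert (E0 : (z + - z)%C = 0) by ring.
assert (H : cder (fun w => (w + - z)%C) z (1 + 0)%C).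
{ apply cder_plus; [apply cder_id|apply cder_const]. }
assert (H' : cder (fun w => cexp (w + - z)%C) z (1 * (1 + 0))%C).
{ apply (cder_comp (fun w => (w + - z)%C) cexp); [assumption|rewrite E0; apply cder_cexp_0]. }
assert (H2 := cder_mult _ _ _ _ _ (cder_const (cexp z) z) H').
refine (eq_rect _ (cder _ z) H2 _ _); cbv beta; ring.
Qed.

(** The Cauchy-Riemann equations. *)
Lemma cder_differentiable f (x y : R) l : cder f (x, y) l ->
  differentiable_pt_lim (fun u v => Re (f (u, v))) x y (Re l) (- Im l) /\
  differentiable_pt_lim (fun u v => Im (f (u, v))) x y (Im l) (Re l).
Proof.
intros H.
assert (K : forall eps : posreal, locally_2d (fun u v =>
  Cmod (f (u, v) - f (x, y) - l * ((u, v) - (x, y))) <=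
  eps * Rmax (Rabs (u - x)) (Rabs (v - y))) x y).
{ intros eps.
  destruct (cder_approx _ _ _ H (eps / 2)) as (d & Hd & Hw).
  { apply Rdiv_lt_0_compat; [apply cond_pos|lra]. }
  assert (Hd2 : 0 < d / 2) by lra.
  exists (mkposreal _ Hd2); simpl; intros u v Hu Hv.
  assert (E : Cmod ((u, v) - (x, y)) <= Rabs (u - x) + Rabs (v - y)).
  { apply (Cmod_le_abs ((u, v) - (x, y))%C). }
  eapply Rle_trans; [apply Hw; lra|].
  replace (eps * _) with (eps / 2 * (2 * Rmax (Rabs (u - x)) (Rabs (v - y)))) by field.
  apply Rmult_le_compat_l; [pose proof (cond_pos eps); lra|].
  pose proof (Rmax_l (Rabs (u - x)) (Rabs (v - y))).
  pose proof (Rmax_r (Rabs (u - x)) (Rabs (v - y))); lra. }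
split; intros eps; destruct (K eps) as [d Hd]; exists d; intros u v Hu Hv;
  specialize (Hd u v Hu Hv); (eapply Rle_trans; [|exact Hd]).
- eapply Rle_trans; [|apply fst_le_Cmod]; right; f_equal.
  unfold Re, Im; simpl; ring.
- eapply Rle_trans; [|apply snd_le_Cmod]; right; f_equal.
  unfold Re, Im; simpl; ring.
Qed.

(** A form of the mean value property: the real part at the centre is at most
    any upper bound of it on a circle.  At the centre itself [f] is only assumed
    continuous, so the lemma covers removable singularities. *)
Lemma mean_value_le f (z0 : C) (R0 : R) (B r : R) :
  (forall z, 0 < Cmod (z - z0) < R0 -> exists l, cder f z l) -> ccont f z0 ->
  0 < r < R0 -> (forall z, Cmod (z - z0) = r -> Re (f z) <= B) -> Re (f z0) <= B.
Proof.
intros Hf Hc Hr HB.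
set (g := fun z => f (z0 + cexp z)%C).
assert (Hmod : forall s t, Cmod (z0 + cexp (s, t) - z0) = exp s).
{ intros s t; replace (z0 + cexp (s, t) - z0)%C with (cexp (s, t)) by ring; apply Cmod_cexp. }
assert (Hg : forall s t, exp s < R0 -> exists l, cder g (s, t) l).
{ intros s t Hs; destruct (Hf (z0 + cexp (s, t))%C) as [l Hl].
  { rewrite Hmod; split; [apply exp_pos|assumption]. }
  exists (l * (0 + cexp (s, t)))%C; unfold g.
  apply (cder_comp (fun w => (z0 + cexp w)%C) f); [|assumption].
  apply cder_plus; [apply cder_const|apply cder_cexp]. }
(* M s is the integral over the circle of radius exp s *)
set (M := fun s => RInt (fun t => Re (g (s, t))) 0 (2 * PI)).
pose proof PI_RGT_0 as HPI.
assert (Hex : forall s, exp s < R0 -> ex_RInt (fun t => Re (g (s, t))) 0 (2 * PI)).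
{ intros s Hs; apply (ex_RInt_continuous (V := R_CompleteNormedModule)); intros t _.
  destruct (Hg s t Hs) as [l Hl]; apply cder_differentiable in Hl; destruct Hl as [Hl _].
  eapply (differentiable_pt_lim_continuous_y (fun u v => Re (g (u, v)))); exact Hl. }
assert (HM : forall s1 s2, s1 < s2 -> exp s2 < R0 -> M s1 = M s2).
{ intros s1 s2 Hs HR.
  assert (G := green_goursat (fun s t => Im (g (s, t))) (fun s t => Re (g (s, t)))
    s1 s2 0 (2 * PI) Hs ltac:(lra)).
  assert (E : forall s, Im (g (s, 2 * PI)) = Im (g (s, 0))).
  { intros s; unfold g, cexp; simpl; rewrite cos_2PI, sin_2PI, cos_0, sin_0; reflexivity. }
  rewrite (RInt_ext (fun x => Im (g (x, 2 * PI))) (fun x => Im (g (x, 0)))) in G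
    by (intros; apply E).
  unfold M; symmetry; eapply Rplus_eq_reg_l, G.
  clear G; intros s t Hs' _.
  destruct (Hg s t) as [l Hl].
  { destruct (Rle_lt_or_eq_dec s s2) as [H|H]; [lra| |now rewrite H].
    apply exp_increasing in H; lra. }
  apply cder_differentiable in Hl; exists (Im l), (Re l), (- Im l); tauto. }
assert (Hln : exp (ln r) = r) by (apply exp_ln; lra).
assert (HMr : M (ln r) <= 2 * PI * B).
{ unfold M; rewrite <- (Rmult_1_l (2 * PI * B)).
  replace (1 * (2 * PI * B)) with (RInt (fun _ => B) 0 (2 * PI)).
  2:{ rewrite RInt_const; unfold scal; simpl; unfold mult; simpl; ring. }
  apply RInt_le; [lra|apply Hex; rewrite Hln; lra|apply ex_RInt_const|].
  intros t _; apply HB; rewrite Hmod; exact Hln. }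
apply Rnot_lt_le; intros Hlt.
destruct (Hc (Re (f z0) - B)) as (d & Hd & Hcd); [lra|].
set (s := ln (Rmin r d / 2)).
assert (Hm : 0 < Rmin r d) by (apply Rmin_pos; lra).
pose proof (Rmin_l r d); pose proof (Rmin_r r d).
assert (Hs : exp s = Rmin r d / 2) by (apply exp_ln; lra).
assert (HMs : 2 * PI * B < M s).
{ unfold M.
  replace (2 * PI * B) with (RInt (fun _ => B) 0 (2 * PI)).
  2:{ rewrite RInt_const; unfold scal; simpl; unfold mult; simpl; ring. }
  apply RInt_lt; [lra| | |].
  - intros t _; destruct (Hg s t ltac:(lra)) as [l Hl].
    apply cder_differentiable in Hl; destruct Hl as [Hl _].
    eapply (differentiable_pt_lim_continuous_y (fun u v => Re (g (u, v)))); exact Hl.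
  - intros t _; apply continuous_const.
  - intros t _.
    assert (K := Hcd (z0 + cexp (s, t))%C ltac:(rewrite Hmod; lra)).
    pose proof (fst_le_Cmod (f (z0 + cexp (s, t)) - f z0)%C) as K'.
    assert (K2 : Rabs (Re (g (s, t)) - Re (f z0)) < Re (f z0) - B).
    { eapply Rle_lt_trans; [|exact K]; exact K'. }
    apply Rabs_def2 in K2; lra. }
rewrite (HM s (ln r)) in HMs; [lra| |rewrite Hln; lra].
apply ln_increasing; lra.
Qed.

(** * Compactness in the plane and the maximum principle *)

(** Heine-Borel as an induction principle on subsets of a compact set [K]. *)
Lemma compact_induction (K : C -> Prop) (R0 : R) (P : (C -> Prop) -> Prop) :
  (forall z, K z -> Cmod z <= R0) ->
  (forall z, ~ K z -> exists d, 0 < d /\ forall w, Cmod (w - z) < d -> ~ K w) ->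
  P (fun _ => False) ->
  (forall A B : C -> Prop, (forall z, A z -> B z) -> P B -> P A) ->
  (forall A B : C -> Prop, P A -> P B -> P (fun z => A z \/ B z)) ->
  (forall z, K z -> exists d, 0 < d /\ P (fun w => K w /\ Cmod (w - z) < d)) ->
  P K.
Proof.
intros Hb Hcl H0 Hmon Hun Hloc.
set (L := Rabs R0 + 1).
assert (HL : 1 <= L /\ R0 < L).
{ unfold L; pose proof (Rabs_pos R0); pose proof (Rle_abs R0); lra. }
set (Q := fun (a b c d : R) (w : C) => K w /\ a <= fst w <= b /\ c <= snd w <= d).
apply Hmon with (Q (- L) L (- L) L).
{ intros z Hz; unfold Q; specialize (Hb z Hz).
  pose proof (fst_le_Cmod z) as H1; pose proof (snd_le_Cmod z) as H2.
  apply Rabs_le_between in H1; apply Rabs_le_between in H2.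
  repeat split; try assumption; lra. }
apply (rect_induction (fun a b c d => P (Q a b c d))); try lra.
- intros a b c d _ _ _ _ _ _ P1 P2 P3 P4.
  eapply Hmon; [|apply (Hun _ _ (Hun _ _ P1 P2) (Hun _ _ P3 P4))].
  intros z (Hz & Hx & Hy); unfold Q.
  destruct (Rle_dec (fst z) ((a + b) / 2)), (Rle_dec (snd z) ((c + d) / 2));
  [left; left|right; left|left; right|right; right]; repeat split; try assumption; lra.
- intros x y _ _.
  assert (Hd : exists d, 0 < d /\ P (fun w => K w /\ Cmod (w - (x, y)) < d)).
  { destruct (classic (K (x, y))) as [HK|HK]; [now apply Hloc|].
    destruct (Hcl _ HK) as (d & Hd & H); exists d; split; [assumption|].
    apply Hmon with (2 := H0); intros w [Hw1 Hw2]; apply (H w); assumption. }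
  destruct Hd as (d & Hd & HP).
  exists (d / 2); split; [lra|].
  intros a b c e A1 A2 A3 A4 A5 A6 A7 A8 _.
  apply Hmon with (2 := HP); intros w (Hw & Hx & Hy); split; [assumption|].
  eapply Rle_lt_trans; [apply Cmod_le_abs|]; simpl.
  assert (Rabs (fst w + - x) <= b - a) by (apply Rabs_le; lra).
  assert (Rabs (snd w + - y) <= e - c) by (apply Rabs_le; lra).
  lra.
Qed.

Lemma compact_max (K : C -> Prop) (R0 : R) (u : C -> R) z1 :
  (forall z, K z -> Cmod z <= R0) ->
  (forall z, ~ K z -> exists d, 0 < d /\ forall w, Cmod (w - z) < d -> ~ K w) ->
  K z1 ->
  (forall z, K z -> ccont (fun w => RtoC (u w)) z) ->
  exists z, K z /\ forall w, K w -> u w <= u z.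
Proof.
intros Hb Hcl H1 Hu.
apply NNPP; intros Hno.
assert (Hup : forall z, K z -> exists z', K z' /\ u z < u z').
{ intros z Hz; apply NNPP; intros Hn; apply Hno; exists z; split; [assumption|].
  intros w Hw; apply Rnot_lt_le; intros Hlt; apply Hn; now exists w. }
destruct (compact_induction K R0 (fun A => exists z', K z' /\ forall w, A w -> u w < u z'))
  as (z & Hz & Hzm); try assumption.
- exists z1; split; [assumption|tauto].
- intros A B HAB (z & Hz & H); exists z; split; auto.
- intros A B (z & Hz & H) (z' & Hz' & H').
  destruct (Rle_dec (u z) (u z')) as [E|E].
  + exists z'; split; [assumption|]; intros w [Hw|Hw]; [specialize (H w Hw); lra|auto].
  + exists z; split; [assumption|]; intros w [Hw|Hw]; [auto|specialize (H' w Hw); lra].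
- intros z Hz; destruct (Hup z Hz) as (z' & Hz' & Hlt).
  destruct (Hu z Hz (u z' - u z)) as (d & Hd & H); [lra|].
  exists d; split; [assumption|]; exists z'; split; [assumption|].
  intros w [_ Hw]; specialize (H w Hw).
  rewrite <- RtoC_minus, Cmod_R in H; apply Rabs_def2 in H; lra.
- specialize (Hzm z Hz); lra.
Qed.

Lemma ccont_conj z : ccont Cconj z.
Proof.
intros eps Heps; exists eps; split; [assumption|intros w Hw].
replace (Cconj w - Cconj z)%C with (Cconj (w - z)); [now rewrite Cmod_conj|].
unfold Cconj, Cminus, Cplus, Copp; simpl; f_equal; ring.
Qed.

Lemma Cmod_sqr (z : C) : Cmod z * Cmod z = fst z * fst z + snd z * snd z.
Proof. pose proof (Cmod2_alt z) as H; unfold Re, Im in H; simpl in H; lra. Qed.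

Lemma Cconj_mult_self (z : C) : (Cconj z * z)%C = RtoC (Cmod z * Cmod z).
Proof.
rewrite Cmod_sqr; destruct z as [x y]; unfold Cconj, Cmult, RtoC; simpl; f_equal; ring.
Qed.

Lemma ccont_ext f g z : (forall w, f w = g w) -> ccont f z -> ccont g z.
Proof. intros H; apply ccont_ext_loc with 1; [lra|auto]. Qed.

Lemma ccont_Cmod_sqr f z : ccont f z -> ccont (fun w => RtoC (Cmod (f w) * Cmod (f w))) z.
Proof.
intros Hf; apply ccont_ext with (fun w => (Cconj (f w) * f w)%C).
{ intros; apply Cconj_mult_self. }
apply ccont_mult; [apply ccont_comp with (f := f)|]; auto using ccont_conj.
Qed.

Lemma closed_ball_closed (c : C) r z : ~ Cmod (z - c) <= r ->
  exists d, 0 < d /\ forall w, Cmod (w - z) < d -> ~ Cmod (w - c) <= r.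
Proof.
intros H; exists (Cmod (z - c) - r); split; [lra|intros w Hw].
pose proof (Cmod_triangle3 z w c) as H'; rewrite (Cmod_minus_sym z w) in H'; lra.
Qed.

Lemma closed_ball_bounded (c : C) r z : Cmod (z - c) <= r -> Cmod z <= Cmod c + r.
Proof. pose proof (Cmod_rev_triangle z c); lra. Qed.

Lemma circle_closed (c : C) r z : Cmod (z - c) <> r ->
  exists d, 0 < d /\ forall w, Cmod (w - z) < d -> Cmod (w - c) <> r.
Proof.
intros H; exists (Rabs (Cmod (z - c) - r)); split; [apply Rabs_pos_lt; lra|intros w Hw E].
pose proof (Cmod_triangle3 z w c) as H1; pose proof (Cmod_triangle3 w z c) as H2.
rewrite (Cmod_minus_sym z w) in H1; revert Hw; unfold Rabs; destruct Rcase_abs; lra.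
Qed.

(** The maximum principle on a closed disc, for a function that is only
    continuous at one point [z0].  Adding [eps |w - c|^2] to [|f|^2] excludes
    interior maxima, by the mean value property of a holomorphic linearisation. *)
Lemma maximum_principle f (c z0 : C) (r M : R) :
  (forall z, Cmod (z - c) <= r -> ccont f z) ->
  (forall z, Cmod (z - c) < r -> z <> z0 -> exists l, cder f z l) ->
  (forall z, Cmod (z - c) = r -> Cmod (f z) <= M) ->
  forall z, Cmod (z - c) <= r -> Cmod (f z) <= M.
Proof.
intros Hc Hd HM z Hz.
assert (Hr : 0 <= r) by (pose proof (Cmod_ge_0 (z - c)); lra).
assert (HM0 : 0 <= M).
{ eapply Rle_trans; [apply Cmod_ge_0|apply (HM (c + RtoC r)%C)].
  replace (c + RtoC r - c)%C with (RtoC r) by ring.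
  rewrite Cmod_R; now apply Rabs_pos_eq. }
assert (Hsq : forall eps, 0 < eps -> Cmod (f z) * Cmod (f z) <= M * M + eps * (r * r)).
{ intros eps Heps.
  set (u := fun w => Cmod (f w) * Cmod (f w) + eps * (Cmod (w - c) * Cmod (w - c))).
  destruct (compact_max (fun w => Cmod (w - c) <= r) (Cmod c + r) u z) as (zm & Hzm & Hmax).
  - apply closed_ball_bounded.
  - apply closed_ball_closed.
  - assumption.
  - intros w Hw; unfold u.
    apply ccont_ext with (fun w => (RtoC (Cmod (f w) * Cmod (f w)) +
      RtoC eps * RtoC (Cmod (w - c) * Cmod (w - c)))%C).
    { intros v; now rewrite <- RtoC_mult, <- RtoC_plus. }
    apply ccont_plus; [apply ccont_Cmod_sqr; auto|].
    apply ccont_mult; [apply ccont_const|].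
    apply (ccont_Cmod_sqr (fun w => (w - c)%C)).
    apply ccont_plus; [apply ccont_id|apply ccont_const].
  - destruct (Rle_lt_or_eq_dec _ _ Hzm) as [Hlt|Heq].
    + exfalso.
      set (R0 := Rmin (r - Cmod (zm - c))
        (if excluded_middle_informative (zm = z0) then 1 else Cmod (zm - z0))).
      assert (HR0 : 0 < R0).
      { apply Rmin_pos; [lra|].
        destruct excluded_middle_informative; [lra|now apply Cmod_minus_pos]. }
      (* u w - u zm is at least Re (k w - k zm) + eps |w - zm|^2 *)
      set (k := fun w => (RtoC 2 * Cconj (f zm) * f w +
        RtoC (2 * eps) * Cconj (zm - c) * w)%C).
      enough (HK : Re (k zm) <= Re (k zm) - eps * (R0 / 2 * (R0 / 2))).
      { enough (0 < eps * (R0 / 2 * (R0 / 2))) by lra.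
        apply Rmult_lt_0_compat; nra. }
      apply (mean_value_le k zm R0 _ (R0 / 2)).
      * intros w [Hw1 Hw2].
        destruct (Hd w) as [l Hl].
        { pose proof (Cmod_triangle3 w zm c).
          pose proof (Rmin_l (r - Cmod (zm - c))
            (if excluded_middle_informative (zm = z0) then 1 else Cmod (zm - z0))).
          unfold R0 in Hw2; lra. }
        { intros ->; revert Hw2; unfold R0.
          destruct excluded_middle_informative as [E|E].
          - subst z0; replace (zm - zm)%C with (RtoC 0) in Hw1 by ring.
            rewrite Cmod_0 in Hw1; lra.
          - intros Hw2; pose proof (Rmin_r (r - Cmod (zm - c)) (Cmod (zm - z0))).
            rewrite Cmod_minus_sym in Hw2; lra. }
        eexists; apply cder_plus; (apply cder_mult; [apply cder_const|]);
          [exact Hl|apply cder_id].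
      * apply ccont_plus; (apply ccont_mult; [apply ccont_const|]); [auto|apply ccont_id].
      * lra.
      * intros w Hw.
        assert (Hmw : u w <= u zm).
        { apply Hmax; pose proof (Cmod_triangle3 w zm c).
          pose proof (Rmin_l (r - Cmod (zm - c))
            (if excluded_middle_informative (zm = z0) then 1 else Cmod (zm - z0))).
          unfold R0 in *; lra. }
        rewrite <- Hw; unfold u in Hmw; unfold k; rewrite !Cmod_sqr in *.
        destruct (f w) as [a b], (f zm) as [a' b'], w as [x y], zm as [x' y'], c as [p q].
        unfold Re, Cconj, Cmult, Cminus, Cplus, Copp, RtoC in *; simpl in *.
        pose proof (Rle_0_sqr (a - a')); pose proof (Rle_0_sqr (b - b')).
        unfold Rsqr in *; lra.
    + specialize (Hmax z Hz); specialize (HM zm Heq); unfold u in Hmax; rewrite Heq in Hmax.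
      pose proof (Cmod_ge_0 (f zm)); pose proof (Cmod_ge_0 (z - c)).
      assert (0 <= eps * (Cmod (z - c) * Cmod (z - c))) by (apply Rmult_le_pos; nra).
      nra. }
apply Rnot_lt_le; intros Hlt.
assert (Hr2 : 0 < r * r + 1) by nra.
set (e := (Cmod (f z) * Cmod (f z) - M * M) / (2 * (r * r + 1))).
assert (He : 0 < e) by (apply Rdiv_lt_0_compat; nra).
specialize (Hsq e He).
assert (E : e * (r * r + 1) = (Cmod (f z) * Cmod (f z) - M * M) / 2) by (unfold e; field; lra).
nra.
Qed.

(** * Holomorphic bijections of the disc *)

(** Were [N] to take a value near [w0] far away from the preimage [z0] of [w0],
    then [1 / (N - w)] would be holomorphic near [z0] and larger at [z0] than on
    a circle around it. *)
Lemma disc_self_bijection_locally_proper N w0 :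
  (forall z, disc z -> exists l, cder N z l) ->
  (forall z w, disc z -> disc w -> N z = N w -> z = w) ->
  (exists z, disc z /\ N z = w0) ->
  exists m r, 0 < m /\ r < 1 /\ forall z, disc z -> Cmod (N z - w0) < m -> Cmod z <= r.
Proof.
intros Hd Hinj (z0 & Hz0 & Hw0); unfold disc in *.
set (e := (1 - Cmod z0) / 2).
assert (He : 0 < e) by (unfold e; lra).
assert (Hin : forall z, Cmod (z - z0) <= e -> Cmod z <= (1 + Cmod z0) / 2).
{ intros z Hz; apply closed_ball_bounded in Hz; unfold e in Hz; lra. }
assert (Hm : exists m, 0 < m /\ forall z, Cmod (z - z0) = e -> m <= Cmod (N z - w0)).
{ apply (compact_induction (fun z => Cmod (z - z0) = e) 1
    (fun A => exists m, 0 < m /\ forall z, A z -> m <= Cmod (N z - w0))).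
  - intros z Hz; specialize (Hin z ltac:(lra)); lra.
  - apply circle_closed.
  - exists 1; split; [lra|tauto].
  - intros A B HAB (m & Hm & H); exists m; auto.
  - intros A B (m & Hm & H) (m' & Hm' & H'); exists (Rmin m m').
    split; [now apply Rmin_pos|].
    pose proof (Rmin_l m m'); pose proof (Rmin_r m m').
    intros z [Hz|Hz]; [specialize (H z Hz)|specialize (H' z Hz)]; lra.
  - intros z Hz.
    assert (Hz1 : Cmod z < 1) by (specialize (Hin z ltac:(lra)); lra).
    assert (Hne : N z <> w0).
    { intros E; rewrite <- Hw0 in E; apply Hinj in E; try assumption.
      subst z; replace (z0 - z0)%C with (RtoC 0) in Hz by ring; rewrite Cmod_0 in Hz; lra. }
    apply Cmod_minus_pos in Hne.
    destruct (Hd z Hz1) as [l Hl]; apply cder_cont in Hl.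
    destruct (Hl (Cmod (N z - w0) / 2)) as (d & Hdp & H); [lra|].
    exists d; split; [assumption|exists (Cmod (N z - w0) / 2); split; [lra|]].
    intros w [_ Hw]; specialize (H w Hw).
    pose proof (Cmod_triangle3 (N z) (N w) w0); rewrite (Cmod_minus_sym (N z) (N w)) in H0; lra. }
destruct Hm as (m & Hm & HN).
exists (m / 2), ((1 + Cmod z0) / 2); split; [lra|split; [lra|]].
intros z Hz Hzm; apply Rnot_lt_le; intros Hlt.
assert (Hout : forall v, Cmod (v - z0) <= e -> (N v - N z)%C <> 0).
{ intros v Hv; specialize (Hin v Hv); apply Cminus_neq_0; intros E.
  apply Hinj in E; [subst; lra|lra|assumption]. }
assert (Hg : forall v, Cmod (v - z0) <= e -> exists l, cder (fun v => / (N v + - N z))%C v l).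
{ intros v Hv; destruct (Hd v) as [l Hl]; [specialize (Hin v Hv); lra|].
  eexists; apply (cder_comp (fun v => (N v + - N z)%C) Cinv).
  - apply cder_plus; [exact Hl|apply cder_const].
  - apply cder_inv, Hout, Hv. }
assert (Hz00 : Cmod (z0 - z0) <= e).
{ replace (z0 - z0)%C with (RtoC 0) by ring; rewrite Cmod_0; lra. }
assert (K := maximum_principle (fun v => / (N v + - N z))%C z0 0 e (/ (m / 2))).
apply K in Hz00 as Hf.
- rewrite Cmod_inv in Hf by (apply Hout, Hz00).
  change (N z0 + - N z)%C with (N z0 - N z)%C in Hf.
  assert (Hp := Cmod_pos _ (Hout z0 Hz00)).
  rewrite Hw0, Cmod_minus_sym in Hf; rewrite Hw0, Cmod_minus_sym in Hp.
  apply Rinv_lt_contravar in Hzm; [lra|apply Rmult_lt_0_compat; lra].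
- intros v Hv; destruct (Hg v Hv) as [l Hl]; apply cder_cont in Hl; exact Hl.
- intros v Hv _; apply Hg; lra.
- intros v Hv; rewrite Cmod_inv by (apply Hout; lra).
  apply Rinv_le_contravar; [lra|].
  specialize (HN v Hv).
  pose proof (Cmod_triangle3 (N v) (N z) w0); change (N v + - N z)%C with (N v - N z)%C; lra.
Qed.

Lemma disc_self_bijection_proper N :
  (forall z, disc z -> exists l, cder N z l) ->
  (forall z w, disc z -> disc w -> N z = N w -> z = w) ->
  (forall w, disc w -> exists z, disc z /\ N z = w) ->
  forall rho, rho < 1 -> exists r, r < 1 /\ forall z, disc z -> Cmod (N z) <= rho -> Cmod z <= r.
Proof.
intros Hd Hinj Hsurj rho Hrho.
enough (H : exists r, r < 1 /\ forall z, disc z -> Cmod (N z - 0) <= rho -> Cmod z <= r).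
{ destruct H as (r & Hr & H); exists r; split; [assumption|intros z Hz HN].
  apply H; [assumption|]; now replace (N z - 0)%C with (N z) by ring. }
apply (compact_induction (fun w => Cmod (w - 0) <= rho) (Cmod 0 + rho)
  (fun A => exists r, r < 1 /\ forall z, disc z -> A (N z) -> Cmod z <= r)).
- apply closed_ball_bounded.
- apply closed_ball_closed.
- exists 0; split; [lra|tauto].
- intros A B HAB (r & Hr & H); exists r; auto.
- intros A B (r & Hr & H) (r' & Hr' & H'); exists (Rmax r r').
  split; [now apply Rmax_lub_lt|].
  pose proof (Rmax_l r r'); pose proof (Rmax_r r r').
  intros z Hz [HA|HA]; [specialize (H z Hz HA)|specialize (H' z Hz HA)]; lra.
- intros w Hw; destruct (disc_self_bijection_locally_proper N w) as (m & r & Hm & Hr & H);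
    try assumption.
  { apply Hsurj; unfold disc; replace w with (w - 0)%C by ring; lra. }
  exists m; split; [assumption|exists r; split; [assumption|]].
  intros z Hz [_ HA]; auto.
Qed.

(** The derivative may fail to exist at the single point [z0]. *)
Lemma cder_zero_constant f (z0 : C) : disc z0 ->
  (forall z, disc z -> ccont f z) ->
  (forall z, disc z -> z <> z0 -> cder f z 0) ->
  forall z, disc z -> f z = f z0.
Proof.
intros Hz0 Hc Hd z Hz.
destruct (classic (z = z0)) as [->|Hne]; [reflexivity|].
assert (Hp := Cmod_minus_pos z z0 Hne).
set (p := fun t : R => (z0 + t * (z - z0))%C).
assert (Hdisc : forall t, 0 <= t <= 1 -> disc (p t)).
{ intros t Ht; unfold disc, p in *.
  replace (z0 + t * (z - z0))%C with (RtoC (1 - t) * z0 + RtoC t * z)%C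
    by (rewrite RtoC_minus; ring).
  eapply Rle_lt_trans; [apply Cmod_triangle|].
  rewrite !Cmod_mult, !Cmod_R, !Rabs_pos_eq by lra.
  destruct (Req_dec t 0) as [->|Ht0]; [lra|].
  assert (t * Cmod z < t * 1) by (apply Rmult_lt_compat_l; lra).
  assert ((1 - t) * Cmod z0 <= (1 - t) * 1) by (apply Rmult_le_compat_l; lra).
  lra. }
assert (Hpp : forall s t, Cmod (p s - p t) = Rabs (s - t) * Cmod (z - z0)).
{ intros s t; unfold p; rewrite <- Cmod_R, <- Cmod_mult, RtoC_minus; f_equal; ring. }
assert (Hreal : forall g : C -> R, (forall v w, Rabs (g v - g w) <= Cmod (v - w)) ->
  g (f (p 1)) = g (f (p 0))).
{ intros g Hg.
  destruct (MVT_gen (fun t => g (f (p t))) 0 1 (fun _ => 0)) as (x & _ & E); [| |lra].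
  - rewrite Rmin_left, Rmax_right by lra; intros t Ht.
    apply is_derive_Reals; intros eps Heps.
    assert (Hpt : p t <> z0).
    { intros E; unfold p in E.
      assert (E' : (RtoC t * (z - z0))%C = 0).
      { replace (RtoC t * (z - z0))%C with (z0 + t * (z - z0) - z0)%C by ring.
        rewrite E; ring. }
      assert (E2 := f_equal Cmod E'); rewrite Cmod_mult, Cmod_R, Cmod_0, Rabs_pos_eq in E2; nra. }
    set (e := eps / (2 * Cmod (z - z0))).
    assert (He : 0 < e) by (apply Rdiv_lt_0_compat; lra).
    destruct (cder_approx _ _ _ (Hd (p t) (Hdisc t ltac:(lra)) Hpt) e He) as (d & Hdp & Hap).
    assert (Hd' : 0 < d / Cmod (z - z0)) by (apply Rdiv_lt_0_compat; lra).
    exists (mkposreal _ Hd'); intros h Hh0 Hh; simpl in Hh.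
    apply Rabs_pos_lt in Hh0 as Hh1.
    assert (Hw := Hap (p (t + h))); rewrite Hpp in Hw.
    replace (t + h - t) with h in Hw by ring.
    assert (E0 : forall a b : C, (a - 0 * b)%C = a) by (intros; ring).
    rewrite E0 in Hw.
    rewrite Rminus_0_r; unfold Rdiv; rewrite Rabs_mult, Rabs_inv.
    apply Rlt_div_l; [assumption|].
    eapply Rle_lt_trans; [apply Hg|]; eapply Rle_lt_trans.
    + apply Hw; apply Rlt_div_r in Hh; assumption.
    + replace (e * (Rabs h * Cmod (z - z0))) with (eps / 2 * Rabs h); [nra|].
      unfold e; field; lra.
  - rewrite Rmin_left, Rmax_right by lra; intros t Ht eps Heps.
    destruct (Hc (p t) (Hdisc t Ht) eps Heps) as (d & Hdp & Hcd).
    exists (d / Cmod (z - z0)); split; [apply Rdiv_lt_0_compat; lra|].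
    intros s [_ Hs]; unfold dist in *; simpl in *; unfold Rdist in *.
    eapply Rle_lt_trans; [apply Hg|apply Hcd]; rewrite Hpp.
    apply Rlt_div_r; assumption. }
assert (E1 : p 1 = z) by (unfold p; ring).
assert (E0 : p 0 = z0) by (unfold p; ring).
rewrite E1, E0 in Hreal.
assert (HR := Hreal fst (fun v w => fst_le_Cmod (v - w)%C)).
assert (HI := Hreal snd (fun v w => snd_le_Cmod (v - w)%C)).
destruct (f z), (f z0); simpl in *; congruence.
Qed.

(** A function of constant modulus has zero derivative: moving in the
    direction [f z / l] would increase the modulus. *)
Lemma unimodular_cder_zero f (z l : C) (d : R) : 0 < d ->
  (forall w, Cmod (w - z) < d -> Cmod (f w) = 1) -> cder f z l -> l = 0.
Proof.
intros Hd Hf (q & Hq & Hl & H).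
apply NNPP; intros Hl0.
assert (Hlp := Cmod_pos l Hl0).
destruct (Hq (Cmod l / 2)) as (e & He & Hqe); [lra|].
assert (Hfz : Cmod (f z) = 1).
{ apply Hf; replace (z - z)%C with (RtoC 0) by ring; rewrite Cmod_0; assumption. }
set (m := Rmin d e); assert (Hm : 0 < m) by (now apply Rmin_pos).
pose proof (Rmin_l d e : m <= d); pose proof (Rmin_r d e : m <= e).
set (t := m * Cmod l / 2).
assert (Ht : 0 < t) by (unfold t; nra).
set (w := (z + RtoC t * f z / l)%C).
assert (Hwz : Cmod (w - z) = m / 2).
{ unfold w; replace (z + RtoC t * f z / l - z)%C with (RtoC t * f z / l)%C by (field; assumption).
  rewrite Cmod_div, Cmod_mult, Hfz, Cmod_R, Rabs_pos_eq by (assumption || lra).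
  unfold t; field; lra. }
assert (Hfw := Hf w ltac:(lra)); assert (Hqw := Hqe w ltac:(lra)).
rewrite Hl in Hqw.
set (s := (q w / l)%C).
assert (Hs : Cmod (s - 1) < / 2).
{ replace (s - 1)%C with ((q w - l) / l)%C by (unfold s; field; assumption).
  rewrite Cmod_div by assumption; apply Rlt_div_l; lra. }
assert (Efw : f w = (f z * (1 + RtoC t * s))%C).
{ assert (E : (w - z = RtoC t * f z / l)%C) by (unfold w, Cdiv; ring).
  rewrite (H w), E; unfold s; field; assumption. }
rewrite Efw, Cmod_mult, Hfz, Rmult_1_l in Hfw.
pose proof (fst_le_Cmod (1 + RtoC t * s)%C) as K1.
pose proof (fst_le_Cmod (s - 1)%C) as K2.
rewrite Hfw in K1; destruct s as [a b]; simpl in K1, K2.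
apply Rabs_le_between in K1.
assert (K3 : Rabs (a + -(1)) < / 2) by lra.
apply Rabs_def2 in K3; nra.
Qed.

(** A holomorphic bijection of the disc with a simple zero at [z0] is
    [c (z - z0) / (1 - conj z0 z)] with [|c| = 1]. *)
Lemma disc_automorphism N (z0 l : C) : disc z0 ->
  (forall z, disc z -> exists l, cder N z l) ->
  (forall z, disc z -> disc (N z)) ->
  (forall z w, disc z -> disc w -> N z = N w -> z = w) ->
  (forall w, disc w -> exists z, disc z /\ N z = w) ->
  N z0 = 0 -> cder N z0 l -> l <> 0 ->
  exists c, Cmod c = 1 /\
    forall z, disc z -> (N z * (1 - Cconj z0 * z) = c * (z - z0))%C.
Proof.
intros Hz0 Hd Hmap Hinj Hsurj HN0 (q & Hqc & Hql & Hq) Hl0.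
assert (Hden : forall z, disc z -> (1 - Cconj z0 * z)%C <> 0).
{ intros z Hz; apply Cneq_0; unfold disc in *.
  pose proof (Cmod_rev_triangle 1 (Cconj z0 * z)) as H.
  rewrite Cmod_1, Cmod_mult, Cmod_conj in H.
  pose proof (Cmod_ge_0 z); pose proof (Cmod_ge_0 z0); nra. }
assert (HNq : forall z, N z = (q z * (z - z0))%C).
{ intros z; rewrite (Hq z), HN0; ring. }
(* F is the quotient of N by the Moebius map vanishing at z0 *)
set (F := fun z => (q z * (1 + - Cconj z0 * z))%C).
assert (Hqd : forall z, disc z -> z <> z0 -> exists l, cder q z l).
{ intros z Hz Hne; destruct (Hd z Hz) as [l' Hl'].
  assert (Hi : cder (fun w => / (w + - z0))%C z
    (- / ((z + - z0) * (z + - z0)) * (1 + 0))%C).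
  { apply (cder_comp (fun w => (w + - z0)%C) Cinv).
    - apply cder_plus; [apply cder_id|apply cder_const].
    - apply cder_inv, Cminus_neq_0, Hne. }
  eexists; apply cder_ext_loc with (fun w => (N w * / (w + - z0))%C) (Cmod (z - z0));
    [now apply Cmod_minus_pos| |apply cder_mult; [exact Hl'|exact Hi]].
  intros w Hw; rewrite HNq; field; apply Cminus_neq_0; intros ->.
  rewrite Cmod_minus_sym in Hw; lra. }
assert (HFd : forall z, disc z -> z <> z0 -> exists l, cder F z l).
{ intros z Hz Hne; destruct (Hqd z Hz Hne) as [l' Hl'].
  eexists; apply cder_mult; [exact Hl'|].
  apply cder_plus; [apply cder_const|].
  apply cder_mult; [apply cder_const|apply cder_id]. }
assert (HFc : forall z, disc z -> ccont F z).
{ intros z Hz; destruct (classic (z = z0)) as [->|Hne].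
  - apply ccont_mult; [assumption|].
    apply ccont_plus; [apply ccont_const|].
    apply ccont_mult; [apply ccont_const|apply ccont_id].
  - destruct (HFd z Hz Hne) as [l' Hl']; now apply cder_cont in Hl'. }
assert (Hqn : forall z, disc z -> q z <> 0).
{ intros z Hz E; destruct (classic (z = z0)) as [->|Hne]; [congruence|].
  apply Hne, Hinj; try assumption; rewrite HN0, HNq, E; ring. }
assert (HFn : forall z, disc z -> F z <> 0).
{ intros z Hz; apply Cmult_neq_0; [now apply Hqn|].
  replace (1 + - Cconj z0 * z)%C with (1 - Cconj z0 * z)%C by ring; now apply Hden. }
(* near the unit circle both N and the Moebius factor have modulus close to 1 *)
assert (Hbd : forall rho, 0 < rho < 1 -> exists r, r < 1 /\ forall z, disc z -> r < Cmod z ->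
  rho <= Cmod (F z) <= / rho).
{ intros rho Hrho.
  destruct (disc_self_bijection_proper N Hd Hinj Hsurj rho) as (r1 & Hr1 & HP); [lra|].
  unfold disc in *.
  set (r2 := 1 - (1 - rho * rho) * ((1 - Cmod z0) / (1 + Cmod z0)) / 2).
  pose proof (Cmod_ge_0 z0) as Hz00.
  assert (Hk : 0 < (1 - Cmod z0) / (1 + Cmod z0)) by (apply Rdiv_lt_0_compat; lra).
  assert (Hrr : 0 < 1 - rho * rho) by nra.
  assert (Hr2 : r2 < 1) by (pose proof (Rmult_lt_0_compat _ _ Hrr Hk); unfold r2; lra).
  exists (Rmax r1 r2); split; [now apply Rmax_lub_lt|].
  intros z Hz Hzr.
  pose proof (Rmax_l r1 r2); pose proof (Rmax_r r1 r2).
  assert (HN1 : rho <= Cmod (N z)).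
  { apply Rnot_lt_le; intros Hlt; specialize (HP z Hz ltac:(lra)); lra. }
  assert (HN2 : Cmod (N z) <= 1) by (left; auto).
  assert (HD := Cmod_pos _ (Hden z Hz)).
  assert (Hid : Cmod (1 - Cconj z0 * z) * Cmod (1 - Cconj z0 * z) -
    Cmod (z - z0) * Cmod (z - z0) = (1 - Cmod z0 * Cmod z0) * (1 - Cmod z * Cmod z)).
  { rewrite !Cmod_sqr; destruct z as [x y], z0 as [a b]; simpl; ring. }
  assert (HDl : 1 - Cmod z0 <= Cmod (1 - Cconj z0 * z)).
  { pose proof (Cmod_rev_triangle 1 (Cconj z0 * z)) as H1.
    rewrite Cmod_1, Cmod_mult, Cmod_conj in H1.
    assert (Cmod z0 * Cmod z <= Cmod z0 * 1) by (apply Rmult_le_compat_l; lra). lra. }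
  pose proof (Cmod_ge_0 z) as Hzp.
  assert (Hz2 : 1 - Cmod z * Cmod z <= (1 - rho * rho) * ((1 - Cmod z0) / (1 + Cmod z0))).
  { unfold r2 in *; nra. }
  assert (Hz3 : (1 - Cmod z0 * Cmod z0) * (1 - Cmod z * Cmod z) <=
    (1 - rho * rho) * ((1 - Cmod z0) * (1 - Cmod z0))).
  { replace ((1 - rho * rho) * ((1 - Cmod z0) * (1 - Cmod z0))) with
      ((1 - Cmod z0 * Cmod z0) * ((1 - rho * rho) * ((1 - Cmod z0) / (1 + Cmod z0))))
      by (field; lra).
    apply Rmult_le_compat_l; [nra|assumption]. }
  set (D := Cmod (1 - Cconj z0 * z)) in *; set (V := Cmod (z - z0)) in *.
  assert (HV0 : 0 <= V) by apply Cmod_ge_0.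
  assert (HVD : V <= D).
  { assert (0 <= (1 - Cmod z0 * Cmod z0) * (1 - Cmod z * Cmod z)) by (apply Rmult_le_pos; nra).
    nra. }
  assert (HDD : (1 - Cmod z0) * (1 - Cmod z0) <= D * D) by (apply Rmult_le_compat; lra).
  assert (HVl : rho * D <= V).
  { assert (1 - rho * rho >= 0) by nra.
    assert ((1 - rho * rho) * ((1 - Cmod z0) * (1 - Cmod z0)) <= (1 - rho * rho) * (D * D))
      by (apply Rmult_le_compat_l; lra).
    assert (rho * D * (rho * D) <= V * V) by nra.
    apply Rnot_lt_le; intros Hlt; nra. }
  assert (HVp : 0 < V) by nra.
  assert (EF : Cmod (F z) * V = Cmod (N z) * D).
  { unfold V, D; rewrite <- !Cmod_mult; f_equal; unfold F; rewrite HNq; ring. }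
  pose proof (Cmod_ge_0 (F z)).
  split.
  - assert (rho * V <= Cmod (F z) * V) by (rewrite EF; apply Rmult_le_compat; lra).
    apply Rmult_le_reg_r with V; assumption.
  - apply Rmult_le_reg_r with (rho * V); [nra|].
    replace (/ rho * (rho * V)) with V by (field; lra).
    replace (Cmod (F z) * (rho * V)) with (rho * (Cmod (F z) * V)) by ring.
    rewrite EF; nra. }
assert (HF1 : forall z, disc z -> Cmod (F z) = 1).
{ intros z Hz.
  assert (Hb : forall rho, 0 < rho < 1 -> rho <= Cmod (F z) <= / rho).
  { intros rho Hrho; destruct (Hbd rho Hrho) as (r & Hr & HB); unfold disc in *.
    set (s := (1 + Rmax (Cmod z) r) / 2).
    pose proof (Rmax_l (Cmod z) r); pose proof (Rmax_r (Cmod z) r).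
    assert (Rmax (Cmod z) r < 1) by now apply Rmax_lub_lt.
    assert (Hs : s < 1 /\ r < s /\ Cmod z <= s) by (unfold s; lra).
    assert (Em : forall w, (w - 0)%C = w) by (intros; ring).
    split.
    - 
      assert (K : Cmod (/ F z) <= / rho).
      { apply (maximum_principle (fun w => / F w)%C 0 z0 s).
        - intros w Hw; rewrite Em in Hw.
          apply (ccont_comp F Cinv); [apply HFc; lra|apply ccont_inv, HFn; lra].
        - intros w Hw Hne; rewrite Em in Hw; destruct (HFd w ltac:(lra) Hne) as [l' Hl'].
          eexists; apply (cder_comp F Cinv); [exact Hl'|apply cder_inv, HFn; lra].
        - intros w Hw; rewrite Em in Hw; rewrite Cmod_inv by (apply HFn; lra).
          apply Rinv_le_contravar; [lra|apply HB; lra].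
        - rewrite Em; lra. }
      rewrite Cmod_inv in K by now apply HFn.
      apply Rinv_le_contravar in K.
      + rewrite !Rinv_inv in K; exact K.
      + apply Rinv_0_lt_compat, Cmod_pos, HFn, Hz.
    - apply (maximum_principle F 0 z0 s).
      + intros w Hw; rewrite Em in Hw; apply HFc; lra.
      + intros w Hw Hne; rewrite Em in Hw; apply HFd; [lra|assumption].
      + intros w Hw; rewrite Em in Hw; apply HB; lra.
      + rewrite Em; lra. }
  apply Rle_antisym; apply Rnot_lt_le; intros Hlt.
  - set (x := Cmod (F z)) in *.
    assert (Hx : 0 < / ((1 + x) / 2) < 1).
    { split; [apply Rinv_0_lt_compat; lra|rewrite <- Rinv_1; apply Rinv_lt_contravar; lra]. }
    specialize (Hb _ Hx); rewrite Rinv_inv in Hb; lra.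
  - assert (Hx := Cmod_ge_0 (F z)); specialize (Hb ((1 + Cmod (F z)) / 2) ltac:(lra)); lra. }
assert (HFconst : forall z, disc z -> F z = F z0).
{ apply cder_zero_constant; try assumption.
  intros z Hz Hne; destruct (HFd z Hz Hne) as [l' Hl'].
  replace (RtoC 0) with l'; [assumption|].
  apply (unimodular_cder_zero F z l' (1 - Cmod z)); [unfold disc in Hz; lra| |assumption].
  intros w Hw; apply HF1; unfold disc; pose proof (Cmod_rev_triangle w z); lra. }
exists (F z0); split; [now apply HF1|].
intros z Hz; rewrite <- (HFconst z Hz), HNq; unfold F; ring.
Qed.

(** * Holomorphic bijections onto the right half-plane *)

(** The map of the disc onto the right half-plane that sends [0] to [1] and the
    boundary point [tau] to infinity. *)
Definition cayley (tau z : C) : C := ((tau + z) / (tau - z))%C.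

Lemma Cconj_unimodular (tau : C) : Cmod tau = 1 -> Cconj tau = (/ tau)%C.
Proof.
intros H; assert (H0 : tau <> 0) by (apply Cneq_0; lra).
assert (E := Cconj_mult_self tau); rewrite H, Rmult_1_l in E.
transitivity (Cconj tau * tau / tau)%C; [field; assumption|rewrite E; field; assumption].
Qed.

Lemma disc_neq_unimodular (tau z : C) : Cmod tau = 1 -> disc z -> (tau - z)%C <> 0.
Proof. intros H Hz; apply Cminus_neq_0; intros ->; unfold disc in Hz; lra. Qed.

Lemma halfplane_disc_ineq (w w0 : C) : 0 < fst w -> 0 < fst w0 ->
  Cmod (w - w0) < Cmod (w + Cconj w0).
Proof.
intros Hw Hw0.
assert (H : Cmod (w - w0) * Cmod (w - w0) < Cmod (w + Cconj w0) * Cmod (w + Cconj w0)).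
{ rewrite !Cmod_sqr; destruct w, w0; simpl in *; nra. }
pose proof (Cmod_ge_0 (w - w0)); pose proof (Cmod_ge_0 (w + Cconj w0)).
apply Rnot_le_lt; intros Hle; nra.
Qed.

(** The last hypothesis says that [Phi] takes large values arbitrarily close to
    [tau]. *)
Lemma halfplane_bijection_normal_form Phi tau : Cmod tau = 1 ->
  (forall z, disc z -> exists l, cder Phi z l) ->
  (forall z, disc z -> 0 < fst (Phi z)) ->
  (forall z w, disc z -> disc w -> Phi z = Phi w -> z = w) ->
  (forall w : C, 0 < fst w -> exists z, disc z /\ Phi z = w) ->
  (forall eps M, 0 < eps -> exists z, disc z /\ Cmod (z - tau) < eps /\ M < Cmod (Phi z)) ->
  exists a b : R, 0 < a /\
    forall z, disc z -> Phi z = (RtoC a * cayley tau z + Ci * RtoC b)%C.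
Proof.
intros Htau Hd Hpos Hinj Hsurj Hinf.
assert (Hz0 : exists z0 l, disc z0 /\ cder Phi z0 l /\ l <> 0).
{ apply NNPP; intros Hno.
  assert (H0 : disc 0) by (unfold disc; rewrite Cmod_0; lra).
  assert (Hconst : forall z, disc z -> Phi z = Phi 0).
  { apply cder_zero_constant; [assumption| |].
    - intros z Hz; destruct (Hd z Hz) as [l Hl]; now apply cder_cont in Hl.
    - intros z Hz _; destruct (Hd z Hz) as [l Hl].
      replace (RtoC 0) with l; [assumption|].
      apply NNPP; intros Hl0; apply Hno; now exists z, l. }
  destruct (Hsurj 1) as (z1 & D1 & E1); [simpl; lra|].
  destruct (Hsurj 2) as (z2 & D2 & E2); [simpl; lra|].
  rewrite Hconst in E1, E2 by assumption; rewrite E1 in E2; injection E2; lra. }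
destruct Hz0 as (z0 & l & Hz0 & Hl & Hl0).
set (w0 := Phi z0) in *.
assert (Hw0 : 0 < fst w0) by now apply Hpos.
set (S := (w0 + Cconj w0)%C).
assert (HS : S = RtoC (2 * fst w0)).
{ unfold S; destruct w0; unfold Cplus, Cconj, RtoC; simpl; f_equal; ring. }
assert (HS0 : S <> 0) by (rewrite HS; intros E; injection E; lra).
assert (Hne : forall w : C, 0 < fst w -> (w + Cconj w0)%C <> 0).
{ intros w Hw E; apply (f_equal fst) in E; simpl in E; lra. }
(* N is a self-bijection of the disc vanishing at z0 *)
set (N := fun z => ((Phi z + - w0) * / (Phi z + Cconj w0))%C).
assert (HN1 : forall z, disc z -> (1 - N z)%C = (S / (Phi z + Cconj w0))%C).
{ intros z Hz; unfold N, S; field; apply Hne, Hpos, Hz. }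
assert (HNd : forall z l', disc z -> cder Phi z l' -> cder N z
  ((l' + 0) * / (Phi z + Cconj w0) + (Phi z + - w0) *
   (- / ((Phi z + Cconj w0) * (Phi z + Cconj w0)) * (l' + 0)))%C).
{ intros z l' Hz Hl'; unfold N.
  apply (cder_mult (fun z => Phi z + - w0)%C (fun z => / (Phi z + Cconj w0))%C).
  - apply cder_plus; [assumption|apply cder_const].
  - apply (cder_comp (fun z => Phi z + Cconj w0)%C Cinv).
    + apply cder_plus; [assumption|apply cder_const].
    + apply cder_inv, Hne, Hpos, Hz. }
destruct (disc_automorphism N z0
  ((l + 0) * / (Phi z0 + Cconj w0) + (Phi z0 + - w0) *
   (- / ((Phi z0 + Cconj w0) * (Phi z0 + Cconj w0)) * (l + 0)))%C) as (c & Hc & HcN).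
- assumption.
- intros z Hz; destruct (Hd z Hz) as [l' Hl']; eexists; apply HNd; [exact Hz|exact Hl'].
- intros z Hz; unfold disc, N; rewrite Cmod_mult, Cmod_inv by apply Hne, Hpos, Hz.
  apply Rlt_div_l; [apply Cmod_pos, Hne, Hpos, Hz|].
  rewrite Rmult_1_l; apply halfplane_disc_ineq; [now apply Hpos|assumption].
- intros z w Hz Hw E; apply Hinj; try assumption.
  assert (E' : (1 - N z = 1 - N w)%C) by now rewrite E.
  rewrite !HN1 in E' by assumption.
  assert (Kz := Hne _ (Hpos z Hz)); assert (Kw := Hne _ (Hpos w Hw)).
  assert (Ez : Phi z = (S / (S / (Phi z + Cconj w0)) - Cconj w0)%C) by (field; auto).
  assert (Ew : Phi w = (S / (S / (Phi w + Cconj w0)) - Cconj w0)%C) by (field; auto).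
  rewrite Ez, Ew, E'; reflexivity.
- intros w Hw.
  assert (Hw1 : (1 - w)%C <> 0) by (apply disc_neq_unimodular; [apply Cmod_1|assumption]).
  set (v := (S / (1 - w) - Cconj w0)%C).
  assert (Hv : 0 < fst v).
  { unfold v; rewrite HS; unfold disc in Hw.
    assert (H1 := Cmod_sqr w); assert (H2 := Cmod_sqr (1 - w)); assert (H3 := Cmod_pos _ Hw1).
    pose proof (Cmod_ge_0 w).
    destruct w as [x y], w0 as [p q].
    unfold Cdiv, Cmult, Cinv, Cminus, Cplus, Copp, Cconj, RtoC in *; simpl in *.
    assert (H5 : 0 < (1 + - x) * (1 + - x) + (0 + - y) * (0 + - y)) by nra.
    match goal with |- 0 < ?e => replace e with
      (p * (1 - (x * x + y * y)) / ((1 + - x) * (1 + - x) + (0 + - y) * (0 + - y))) end.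
    - apply Rdiv_lt_0_compat; [apply Rmult_lt_0_compat; nra|assumption].
    - field; lra. }
  destruct (Hsurj v Hv) as (z & Hz & Ez); exists z; split; [assumption|].
  unfold N; rewrite Ez; unfold v, S; field; split; [assumption|].
  intros E; apply HS0; unfold S; rewrite <- E; ring.
- unfold N; fold w0; ring.
- apply HNd; assumption.
- intros E; apply Hl0.
  fold w0 in E; fold S in E.
  replace ((l + 0) * / S + (w0 + - w0) * (- / (S * S) * (l + 0)))%C with (l / S)%C in E
    by (field; assumption).
  replace l with (l / S * S)%C by (field; assumption); rewrite E; ring.
(* T tau = 0 says that the Moebius map equal to N sends tau to 1 *)
-
  set (zb := Cconj z0) in *.
  set (T := fun z => ((1 - zb * z) - c * (z - z0))%C).
  assert (HTz : forall z, disc z -> T z = (S / (Phi z + Cconj w0) * (1 - zb * z))%C).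
  { intros z Hz; rewrite <- HN1 by assumption; unfold T; rewrite <- HcN by assumption; ring. }
  assert (Hzb : Cmod zb < 1) by (unfold zb; rewrite Cmod_conj; exact Hz0).
  assert (HTtau : T tau = 0).
  { apply NNPP; intros HT0; apply Cmod_pos in HT0.
    set (e := Cmod (T tau)) in *.
    destruct (Hinf (e / 8) (Cmod w0 + 8 * Cmod S / e)) as (z & Hz & Hzt & HM); [lra|].
    assert (H1 : Cmod (T tau - T z) <= e / 4).
    { replace (T tau - T z)%C with ((zb + c) * (z - tau))%C by (unfold T; ring).
      rewrite Cmod_mult; pose proof (Cmod_triangle zb c); pose proof (Cmod_ge_0 (zb + c)).
      pose proof (Cmod_ge_0 (z - tau)).
      replace (e / 4) with (2 * (e / 8)) by field; apply Rmult_le_compat; lra. }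
    assert (H2 : Cmod (T z) <= e / 4).
    { rewrite HTz, Cmod_mult, Cmod_div by first [assumption|apply Hne, Hpos, Hz].
      assert (K1 : Cmod (1 - zb * z) <= 2).
      { eapply Rle_trans; [apply Cmod_triangle|].
        rewrite Cmod_opp, Cmod_1, Cmod_mult; unfold disc in Hz.
        pose proof (Cmod_ge_0 zb); pose proof (Cmod_ge_0 z); nra. }
      assert (K2 : 8 * Cmod S / e < Cmod (Phi z + Cconj w0)).
      { pose proof (Cmod_rev_triangle (Phi z) (- Cconj w0)) as K.
        replace (Phi z - - Cconj w0)%C with (Phi z + Cconj w0)%C in K by ring.
        rewrite Cmod_opp, Cmod_conj in K; lra. }
      assert (HSp := Cmod_pos _ HS0).
      assert (K3 : Cmod S / Cmod (Phi z + Cconj w0) <= e / 8).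
      { assert (0 < 8 * Cmod S / e) by (apply Rdiv_lt_0_compat; lra).
        apply Rle_div_l; [lra|].
        replace (Cmod S) with (e / 8 * (8 * Cmod S / e)) by (field; lra).
        apply Rmult_le_compat_l; lra. }
      replace (e / 4) with (e / 8 * 2) by field.
      apply Rmult_le_compat; try assumption; [|apply Cmod_ge_0].
      apply Rdiv_le_0_compat; [lra|apply Cmod_pos, Hne, Hpos, Hz]. }
    pose proof (Cmod_rev_triangle (T tau) (T z)); fold e in H; lra. }
  set (K := (1 - z0 * zb)%C).
  assert (HK : K = RtoC (1 - Cmod z0 * Cmod z0)).
  { unfold K, zb; rewrite Cmult_comm, Cconj_mult_self, RtoC_minus; reflexivity. }
  assert (HKp : 0 < 1 - Cmod z0 * Cmod z0).
  { unfold disc in Hz0; pose proof (Cmod_ge_0 z0); nra. }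
  assert (HK0 : K <> 0) by (rewrite HK; intros E; injection E; lra).
  assert (Htz0 := disc_neq_unimodular tau z0 Htau Hz0).
  assert (Ht0 : tau <> 0) by (apply Cneq_0; lra).
  assert (Ec : c = ((1 - zb * tau) / (tau - z0))%C).
  { unfold T in HTtau.
    replace c with ((1 - zb * tau - ((1 - zb * tau) - c * (tau - z0))) / (tau - z0))%C
      by (field; assumption).
    rewrite HTtau; field; assumption. }
  assert (Ezbc : (zb + c = K / (tau - z0))%C) by (rewrite Ec; unfold K; field; assumption).
  set (A := (S * (1 - z0 * Cconj tau) / K - Cconj w0)%C).
  set (A' := (S * (1 - zb * tau) / K - w0)%C).
  assert (EA' : A' = Cconj A).
  { unfold A', A; rewrite HK, HS; unfold zb; clear.
    set (s := 2 * fst w0); set (m := 1 - Cmod z0 * Cmod z0).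

    destruct z0, tau, w0; unfold Cdiv, Cconj, Cmult, Cinv, Cminus, Cplus, Copp, RtoC; simpl.
    f_equal; unfold Rdiv; ring. }
  assert (HA : 0 < fst A).
  { unfold A; rewrite HK, HS.
    assert (G1 := Cmod_sqr z0); assert (G2 := Cmod_sqr tau); rewrite Htau in G2.
    assert (G3 := Cmod_sqr (tau - z0)); assert (G4 := Cmod_pos _ Htz0).
    rewrite G1 in *; clear - HKp Hw0 G2 G3 G4.
    destruct z0 as [x y], tau as [p q], w0 as [u v];
      unfold Cdiv, Cconj, Cmult, Cinv, Cminus, Cplus, Copp, RtoC in *; simpl in *.
    match goal with |- 0 < ?e => replace e with
      (u * ((p + - x) * (p + - x) + (q + - y) * (q + - y)) / (1 - (x * x + y * y))) end.
    - apply Rdiv_lt_0_compat; [apply Rmult_lt_0_compat; nra|assumption].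
    - replace ((p + - x) * (p + - x) + (q + - y) * (q + - y)) with
        (2 * (1 - x * p - y * q) - (1 - (x * x + y * y))) by nra.
      field; lra. }
  exists (fst A), (snd A); split; [assumption|].
  intros z Hz.
  assert (Htz := disc_neq_unimodular tau z Htau Hz).
  assert (EA : A = (RtoC (fst A) + Ci * RtoC (snd A))%C).
  { destruct A; unfold Cplus, Cmult, Ci, RtoC; simpl; f_equal; ring. }
  assert (EAc : A' = (RtoC (fst A) - Ci * RtoC (snd A))%C).
  { rewrite EA'; destruct A; unfold Cminus, Cconj, Copp, Cplus, Cmult, Ci, RtoC; simpl; f_equal; ring. }
  transitivity ((A * tau + A' * z) / (tau - z))%C.
  2:{ rewrite EAc; rewrite EA at 1; unfold cayley; field; assumption. }
  assert (ET : T z = (K * (tau - z) / (tau - z0))%C).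
  { replace (T z) with (T tau + (zb + c) * (tau - z))%C by (unfold T; ring).
    rewrite HTtau, Ezbc; field; assumption. }
  assert (HTz' := HTz z Hz); rewrite ET in HTz'.
  assert (Kp := Hne _ (Hpos z Hz)).
  assert (EP : (Phi z + Cconj w0 = S * (1 - zb * z) * (tau - z0) / (K * (tau - z)))%C).
  { replace (S * (1 - zb * z) * (tau - z0) / (K * (tau - z)))%C with
     ((S / (Phi z + Cconj w0) * (1 - zb * z)) * (Phi z + Cconj w0) * (tau - z0) / (K * (tau - z)))%C
     by (field; auto).
    rewrite <- HTz'; field; auto. }
  replace (Phi z) with (Phi z + Cconj w0 - Cconj w0)%C by ring.
  rewrite EP; unfold A, A'; rewrite (Cconj_unimodular tau Htau).
  assert (EKz : K = (1 - z0 * zb)%C) by reflexivity.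
  assert (HK0' : (1 - z0 * zb)%C <> 0) by exact HK0.
  unfold S; rewrite EKz; field; auto.
Qed.

(** * Hyperbolic distance in the half-plane coordinate *)

(** The squared hyperbolic cosine of the distance, in the half-plane, between
    [Z] and [W]; it equals [1 / (1 - T^2)], where [T] is the pseudohyperbolic
    distance. *)
Definition halfplane_ratio (Z W : C) : R :=
  Cmod (Z + Cconj W) * Cmod (Z + Cconj W) / (4 * fst Z * fst W).

Lemma Re_cayley (tau z : C) : Cmod tau = 1 -> disc z ->
  fst (cayley tau z) = (1 - Cmod z * Cmod z) / (Cmod (tau - z) * Cmod (tau - z)).
Proof.
intros Htau Hz.
assert (H0 := Cmod_pos _ (disc_neq_unimodular tau z Htau Hz)).
assert (H1 := Cmod_sqr tau); rewrite Htau in H1.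
assert (H2 := Cmod_sqr (tau - z)).
assert (H3 : 0 < Cmod (tau - z) * Cmod (tau - z)) by nra.
rewrite H2 in *; rewrite (Cmod_sqr z).
destruct tau as [p q], z as [x y]; unfold cayley, Cdiv, Cmult, Cinv, Cminus, Cplus, Copp in *;
  simpl in *.
replace (1 - (x * x + y * y)) with (p * p + q * q - (x * x + y * y)) by lra.
field; lra.
Qed.

Lemma Re_cayley_pos (tau z : C) : Cmod tau = 1 -> disc z -> 0 < fst (cayley tau z).
Proof.
intros Htau Hz; rewrite Re_cayley by assumption.
assert (H0 := Cmod_pos _ (disc_neq_unimodular tau z Htau Hz)).
unfold disc in Hz; pose proof (Cmod_ge_0 z).
apply Rdiv_lt_0_compat; nra.
Qed.

Lemma moebius_denominator_pos (z w : C) : disc z -> disc w -> 0 < Cmod (1 - Cconj z * w).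
Proof.
unfold disc; intros Hz Hw.
pose proof (Cmod_rev_triangle 1 (Cconj z * w)) as H.
rewrite Cmod_1, Cmod_mult, Cmod_conj in H.
pose proof (Cmod_ge_0 z); pose proof (Cmod_ge_0 w); nra.
Qed.

Lemma one_minus_moebius_sqr (tau z w : C) : Cmod tau = 1 -> disc z -> disc w ->
  1 - Cmod (moebius z w) * Cmod (moebius z w)
  = / halfplane_ratio (cayley tau z) (cayley tau w).
Proof.
intros Htau Hz Hw.
assert (HD := moebius_denominator_pos z w Hz Hw).
assert (Htz := disc_neq_unimodular tau z Htau Hz).
assert (Htw := disc_neq_unimodular tau w Htau Hw).
assert (Htz' := Cmod_pos _ Htz); assert (Htw' := Cmod_pos _ Htw).
assert (Ht0 : tau <> 0) by (apply Cneq_0; lra).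
assert (ED : Cmod (1 - z * Cconj w) = Cmod (1 - Cconj z * w)).
{ rewrite <- Cmod_conj; f_equal; destruct z, w; unfold Cconj, Cmult, Cminus, Cplus, Copp, RtoC;
    simpl; f_equal; ring. }
assert (ES : Cmod (cayley tau z + Cconj (cayley tau w)) =
  2 * Cmod (1 - Cconj z * w) / (Cmod (tau - z) * Cmod (tau - w))).
{ assert (Ew : Cconj (cayley tau w) = ((/ tau + Cconj w) / (/ tau - Cconj w))%C).
  { rewrite <- (Cconj_unimodular tau Htau); unfold cayley, Cdiv.
    assert (Em : forall a b, Cconj (a * b) = (Cconj a * Cconj b)%C).
    { intros [] []; unfold Cconj, Cmult; simpl; f_equal; ring. }
    rewrite Em, Cinv_conj by assumption; f_equal; [|f_equal];
    destruct tau, w; unfold Cconj, Cminus, Cplus, Copp; simpl; f_equal; ring. }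
  assert (Hc : (/ tau - Cconj w)%C <> 0).
  { rewrite <- (Cconj_unimodular tau Htau).
    replace (Cconj tau - Cconj w)%C with (Cconj (tau - w)).
    - apply Cneq_0; rewrite Cmod_conj; assumption.
    - destruct tau, w; unfold Cconj, Cminus, Cplus, Copp; simpl; f_equal; ring. }
  assert (Hcm : Cmod (/ tau - Cconj w) = Cmod (tau - w)).
  { rewrite <- (Cconj_unimodular tau Htau), <- (Cmod_conj (tau - w)); f_equal.
    destruct tau, w; unfold Cconj, Cminus, Cplus, Copp; simpl; f_equal; ring. }
  assert (Hc' : (1 - tau * Cconj w)%C <> 0).
  { replace (1 - tau * Cconj w)%C with (tau * (/ tau - Cconj w))%C by (field; assumption).
    now apply Cmult_neq_0. }
  rewrite Ew; unfold cayley.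
  replace ((tau + z) / (tau - z) + (/ tau + Cconj w) / (/ tau - Cconj w))%C
    with (RtoC 2 * (1 - z * Cconj w) / ((tau - z) * (/ tau - Cconj w)))%C.
  - rewrite Cmod_div, !Cmod_mult, Hcm, ED, Cmod_R, Rabs_pos_eq by (lra || now apply Cmult_neq_0).
    reflexivity.
  - field; repeat split; auto; now rewrite Cmult_comm. }
unfold halfplane_ratio; rewrite ES, !Re_cayley by assumption.
unfold moebius; rewrite Cmod_div by (apply Cneq_0, HD).
assert (Hid : Cmod (1 - Cconj z * w) * Cmod (1 - Cconj z * w) - Cmod (z - w) * Cmod (z - w)
  = (1 - Cmod z * Cmod z) * (1 - Cmod w * Cmod w)).
{ rewrite !Cmod_sqr; destruct z, w; simpl; ring. }
unfold disc in *; pose proof (Cmod_ge_0 z); pose proof (Cmod_ge_0 w).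
assert (0 < 1 - Cmod z * Cmod z) by nra; assert (0 < 1 - Cmod w * Cmod w) by nra.
set (D := Cmod (1 - Cconj z * w)) in *.
apply Rmult_eq_reg_r with (D * D); [|nra].
transitivity ((1 - Cmod z * Cmod z) * (1 - Cmod w * Cmod w)).
- rewrite <- Hid; field; lra.
- field; repeat split; nra.
Qed.

Lemma halfplane_ratio_pos (Z W : C) : 0 < fst Z -> 0 < fst W -> 0 < halfplane_ratio Z W.
Proof.
intros HZ HW; unfold halfplane_ratio; rewrite Cmod_sqr.
apply Rdiv_lt_0_compat; [|nra].
destruct Z as [a b], W as [c d]; simpl in *.
assert (0 < (a + c) * (a + c)) by (apply Rmult_lt_0_compat; lra).
pose proof (Rle_0_sqr (b + - d)); unfold Rsqr in *; lra.
Qed.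

Lemma moebius_lt_1 (tau z w : C) : Cmod tau = 1 -> disc z -> disc w ->
  0 <= Cmod (moebius z w) < 1.
Proof.
intros Htau Hz Hw; split; [apply Cmod_ge_0|].
assert (H := one_minus_moebius_sqr tau z w Htau Hz Hw).
assert (H' : 0 < / halfplane_ratio (cayley tau z) (cayley tau w)).
{ apply Rinv_0_lt_compat, halfplane_ratio_pos; now apply Re_cayley_pos. }
pose proof (Cmod_ge_0 (moebius z w)); nra.
Qed.

(** The identity [(1 + T) / (1 - T) = (1 + T)^2 / (1 - T^2)] compares the
    distance with the logarithm of the ratio, up to [ln 2]. *)
Lemma hyp_dist_bounds (tau z w : C) : Cmod tau = 1 -> disc z -> disc w ->
  / 2 * ln (halfplane_ratio (cayley tau z) (cayley tau w)) <= hyp_dist z w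
  <= / 2 * ln (halfplane_ratio (cayley tau z) (cayley tau w)) + ln 2.
Proof.
intros Htau Hz Hw.
assert (HT := moebius_lt_1 tau z w Htau Hz Hw).
assert (H := one_minus_moebius_sqr tau z w Htau Hz Hw).
assert (Hp : 0 < halfplane_ratio (cayley tau z) (cayley tau w)).
{ apply halfplane_ratio_pos; now apply Re_cayley_pos. }
unfold hyp_dist; set (T := Cmod (moebius z w)) in *.
set (r := halfplane_ratio (cayley tau z) (cayley tau w)) in *.
assert (E : (1 + T) / (1 - T) = (1 + T) * (1 + T) * r).
{ rewrite <- (Rinv_inv r), <- H; field; nra. }
rewrite E, !ln_mult by nra.
assert (0 <= ln (1 + T)) by (rewrite <- ln_1; apply ln_le; lra).
assert (ln (1 + T) <= ln 2) by (apply ln_le; lra).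
lra.
Qed.

Lemma hyp_dist_le_iff (tau z w w' : C) : Cmod tau = 1 -> disc z -> disc w -> disc w' ->
  (hyp_dist z w <= hyp_dist z w' <->
   halfplane_ratio (cayley tau z) (cayley tau w)
   <= halfplane_ratio (cayley tau z) (cayley tau w')).
Proof.
intros Htau Hz.
assert (Hmono : forall v v', disc v -> disc v' ->
  halfplane_ratio (cayley tau z) (cayley tau v) < halfplane_ratio (cayley tau z) (cayley tau v')
  -> hyp_dist z v < hyp_dist z v').
{ intros v v' Hv Hv' Hlt.
  assert (HT := moebius_lt_1 tau z v Htau Hz Hv).
  assert (HT' := moebius_lt_1 tau z v' Htau Hz Hv').
  assert (H := one_minus_moebius_sqr tau z v Htau Hz Hv).
  assert (H' := one_minus_moebius_sqr tau z v' Htau Hz Hv').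
  assert (Hp : 0 < halfplane_ratio (cayley tau z) (cayley tau v)).
  { apply halfplane_ratio_pos; now apply Re_cayley_pos. }
  apply Rinv_lt_contravar in Hlt; [|apply Rmult_lt_0_compat; lra].
  rewrite <- H, <- H' in Hlt.
  unfold hyp_dist; apply Rmult_lt_compat_l; [lra|].
  set (T := Cmod (moebius z v)) in *; set (T' := Cmod (moebius z v')) in *.
  assert (T < T') by nra.
  apply ln_increasing; [apply Rdiv_lt_0_compat; lra|].
  apply Rlt_div_l; [lra|].
  replace ((1 + T') / (1 - T') * (1 - T)) with ((1 + T') * (1 - T) / (1 - T')) by (field; lra).
  apply Rlt_div_r; [lra|nra]. }
assert (Heq : forall v v', disc v -> disc v' ->
  halfplane_ratio (cayley tau z) (cayley tau v) = halfplane_ratio (cayley tau z) (cayley tau v')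
  -> hyp_dist z v = hyp_dist z v').
{ intros v v' Hv Hv' E.
  assert (HT := moebius_lt_1 tau z v Htau Hz Hv).
  assert (HT' := moebius_lt_1 tau z v' Htau Hz Hv').
  assert (H := one_minus_moebius_sqr tau z v Htau Hz Hv).
  assert (H' := one_minus_moebius_sqr tau z v' Htau Hz Hv').
  unfold hyp_dist; replace (Cmod (moebius z v)) with (Cmod (moebius z v')); [reflexivity|].
  rewrite E in H; nra. }
intros Hw Hw'; split; intros H.
- apply Rnot_lt_le; intros Hlt; specialize (Hmono w' w Hw' Hw Hlt); lra.
- destruct H as [H|H]; [left; auto|right; auto].
Qed.

Lemma cayley_diameter (tau : C) (r : R) : Cmod tau = 1 -> -1 < r < 1 ->
  disc (RtoC r * tau) /\ cayley tau (RtoC r * tau) = RtoC ((1 + r) / (1 - r)).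
Proof.
intros Htau Hr.
assert (Ht0 : tau <> 0) by (apply Cneq_0; lra).
split.
- unfold disc; rewrite Cmod_mult, Htau, Cmod_R, Rmult_1_r; apply Rabs_def1; lra.
- unfold cayley; rewrite RtoC_div, RtoC_plus, RtoC_minus by lra.
  assert ((1 - RtoC r)%C <> 0).
  { rewrite <- RtoC_minus; intros E; injection E; lra. }
  assert ((tau - r * tau)%C <> 0).
  { replace (tau - r * tau)%C with (tau * (1 - RtoC r))%C by ring; now apply Cmult_neq_0. }
  field; split; assumption.
Qed.

Lemma halfplane_ratio_real (Z : C) (x : R) : 0 < fst Z -> 0 < x ->
  halfplane_ratio Z (RtoC x) = (Cmod Z * Cmod Z / x + x + 2 * fst Z) / (4 * fst Z).
Proof.
intros HZ Hx; unfold halfplane_ratio; rewrite !Cmod_sqr; destruct Z; simpl in *; field; lra.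
Qed.

(** In the half-plane the closest point of the positive half-line to [w] is
    [|w|]. *)
Lemma proj_diameter_eq (tau z : C) : Cmod tau = 1 -> disc z ->
  let rho := Cmod (cayley tau z) in
  disc (proj_diameter tau z) /\ cayley tau (proj_diameter tau z) = RtoC rho.
Proof.
intros Htau Hz rho.
assert (HX := Re_cayley_pos tau z Htau Hz).
assert (Hrho : 0 < rho).
{ apply Cmod_pos; intros E; rewrite E in HX; simpl in HX; lra. }
set (s := (rho - 1) / (rho + 1)).
assert (Hs : -1 < s < 1).
{ unfold s; split; [apply Rlt_div_r; lra|apply Rlt_div_l; lra]. }
assert (Es : (1 + s) / (1 - s) = rho) by (unfold s; field; lra).
destruct (cayley_diameter tau s Htau Hs) as [D0 C0]; rewrite Es in C0.
assert (Hclosest : is_closest_on_diameter tau z (RtoC s * tau)).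
{ split; [now exists s|].
  intros w' (r & Hr & ->).
  destruct (cayley_diameter tau r Htau Hr) as [D1 C1].
  apply (hyp_dist_le_iff tau); try assumption.
  assert (Hx : 0 < (1 + r) / (1 - r)) by (apply Rdiv_lt_0_compat; lra).
  rewrite C0, C1, !halfplane_ratio_real by assumption; fold rho.
  set (x := (1 + r) / (1 - r)) in *.
  apply Rmult_le_compat_r; [left; apply Rinv_0_lt_compat; lra|].
  apply Rplus_le_compat_r.
  replace (rho * rho / rho + rho) with (2 * rho) by (field; lra).
  apply Rmult_le_reg_r with x; [assumption|].
  replace ((rho * rho / x + x) * x) with (rho * rho + x * x) by (field; lra).
  pose proof (Rle_0_sqr (rho - x)); unfold Rsqr in *; lra. }
assert (Hspec : is_closest_on_diameter tau z (proj_diameter tau z)).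
{ unfold proj_diameter; apply epsilon_spec; now exists (RtoC s * tau)%C. }
destruct Hspec as [(r & Hr & Er) Hmin].
destruct (cayley_diameter tau r Htau Hr) as [D1 C1]; rewrite Er in *.
split; [assumption|]; rewrite C1; f_equal.
specialize (Hmin _ (proj1 Hclosest)).
apply (hyp_dist_le_iff tau) in Hmin; try assumption.
assert (Hx : 0 < (1 + r) / (1 - r)) by (apply Rdiv_lt_0_compat; lra).
rewrite C0, C1, !halfplane_ratio_real in Hmin by assumption; fold rho in Hmin.
set (x := (1 + r) / (1 - r)) in *.
apply Rmult_le_reg_r in Hmin; [|apply Rinv_0_lt_compat; lra].
apply Rplus_le_reg_r in Hmin.
replace (rho * rho / rho + rho) with (2 * rho) in Hmin by (field; lra).
apply Rmult_le_compat_r with (r := x) in Hmin; [|lra].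
replace ((rho * rho / x + x) * x) with (rho * rho + x * x) in Hmin by (field; lra).
pose proof (Rle_0_sqr (x - rho)).
apply Rminus_diag_uniq, Rsqr_0_uniq; unfold Rsqr in *; lra.
Qed.

(** * The sector as a half-plane *)

Lemma sector_cexp alpha beta u :
  sector alpha beta u <-> exists zeta, - alpha < snd zeta < beta /\ cexp zeta = u.
Proof.
split.
- intros (r & theta & Hr & Ht & ->); exists (ln r, theta); split; [exact Ht|].
  unfold cexp; simpl; rewrite exp_ln by assumption; reflexivity.
- intros ([x y] & Hy & <-); exists (exp x), y; split; [apply exp_pos|split; [exact Hy|reflexivity]].
Qed.

Lemma cexp_injective_strip (zeta zeta' : C) : Rabs (snd zeta - snd zeta') < 2 * PI ->
  cexp zeta = cexp zeta' -> zeta = zeta'.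
Proof.
destruct zeta as [x y], zeta' as [x' y']; simpl; intros Hy E.
assert (Ex : x = x').
{ assert (Em := f_equal Cmod E); rewrite !Cmod_cexp in Em; now apply exp_inv. }
subst x'; f_equal.
unfold cexp in E; simpl in E; injection E as E1 E2.
pose proof (exp_pos x) as Hx.
apply Rmult_eq_reg_l in E1; [|lra]; apply Rmult_eq_reg_l in E2; [|lra].
assert (Hc : cos (y - y') = 1).
{ rewrite cos_minus, E1, E2; pose proof (sin2_cos2 y'); unfold Rsqr in *; lra. }
replace (y - y') with (2 * ((y - y') / 2)) in Hc by field.
rewrite cos_2a_sin in Hc.
assert (Hs : sin ((y - y') / 2) = 0) by nra.
apply Rabs_def2 in Hy.
destruct (Rtotal_order y y') as [H|[H|H]]; [|assumption|].
- assert (0 < sin (- ((y - y') / 2))) by (apply sin_gt_0; lra).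
  rewrite sin_neg in *; lra.
- assert (0 < sin ((y - y') / 2)) by (apply sin_gt_0; lra); lra.
Qed.

Lemma halfplane_log (w : C) : 0 < fst w ->
  cexp (ln (Cmod w), atan (snd w / fst w)) = w.
Proof.
intros Hw; assert (Hm : 0 < Cmod w).
{ apply Cmod_pos; intros E; rewrite E in Hw; simpl in Hw; lra. }
unfold cexp; cbn [fst snd]; rewrite exp_ln by assumption.
rewrite cos_atan, sin_atan.
assert (E : Cmod w = fst w * sqrt (1 + Rsqr (snd w / fst w))).
{ rewrite <- (sqrt_Rsqr (fst w)) at 1 by lra; rewrite <- sqrt_mult.
  - unfold Cmod; f_equal; unfold Rsqr; field; lra.
  - apply Rle_0_sqr.
  - pose proof (Rle_0_sqr (snd w / fst w)); lra. }
assert (Hs : 0 < sqrt (1 + Rsqr (snd w / fst w))).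
{ apply sqrt_lt_R0; pose proof (Rle_0_sqr (snd w / fst w)); lra. }
rewrite E; destruct w as [x y]; simpl in *.
assert (Hs' : sqrt (1 + Rsqr (y / x)) <> 0) by lra.
f_equal; field; try split; lra.
Qed.

(** Small logarithms of numbers close to [1]. *)
Lemma cexp_local_inverse eps : 0 < eps -> exists delta, 0 < delta /\
  forall w : C, Cmod (w - 1) < delta -> exists zeta, cexp zeta = w /\ Cmod zeta < eps.
Proof.
intros Heps.
destruct (derivable_pt_lim_approx ln 1 (/ 1) (derivable_pt_lim_ln 1 ltac:(lra)) 1 ltac:(lra))
  as (d1 & D1 & H1).
destruct (derivable_pt_lim_approx atan 0 _ (derivable_pt_lim_atan 0) 1 ltac:(lra))
  as (d2 & D2 & H2).
set (d := Rmin (Rmin d1 (d2 / 2)) (Rmin (/ 2) (eps / 8))).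
assert (Hd : d <= d1 /\ d <= d2 / 2 /\ d <= / 2 /\ d <= eps / 8).
{ unfold d; pose proof (Rmin_l (Rmin d1 (d2 / 2)) (Rmin (/ 2) (eps / 8))).
  pose proof (Rmin_r (Rmin d1 (d2 / 2)) (Rmin (/ 2) (eps / 8))).
  pose proof (Rmin_l d1 (d2 / 2)); pose proof (Rmin_r d1 (d2 / 2)).
  pose proof (Rmin_l (/ 2) (eps / 8)); pose proof (Rmin_r (/ 2) (eps / 8)); lra. }
exists d; split; [repeat apply Rmin_pos; lra|intros w Hw].
pose proof (fst_le_Cmod (w - 1)) as K1; pose proof (snd_le_Cmod (w - 1)) as K2.
pose proof (Cmod_rev_triangle w 1) as K3; pose proof (Cmod_rev_triangle 1 w) as K4.
rewrite Cmod_minus_sym in K4; rewrite Cmod_1 in *.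
destruct w as [x y]; simpl in K1, K2.
set (m := Cmod ((x, y) - 1)) in *.
assert (Hm : 0 <= m) by apply Cmod_ge_0.
apply Rabs_le_between in K1; replace (y + - 0) with y in K2 by ring.
exists (ln (Cmod (x, y)), atan (y / x)); split.
- apply (halfplane_log (x, y)); simpl; lra.
- eapply Rle_lt_trans; [apply Cmod_le_abs|]; simpl.
  assert (A1 : Rabs (Cmod (x, y) - 1) <= m) by (apply Rabs_le; lra).
  assert (A2 : Rabs (ln (Cmod (x, y))) <= 2 * m).
  { specialize (H1 (Cmod (x, y) - 1) ltac:(lra)).
    replace (1 + (Cmod (x, y) - 1)) with (Cmod (x, y)) in H1 by ring.
    rewrite ln_1 in H1; apply Rabs_le_between in H1; apply Rabs_le_between in A1.
    revert H1; unfold Rabs; destruct Rcase_abs; intros; destruct Rcase_abs; lra. }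
  assert (A3 : Rabs (y / x) <= 2 * m).
  { unfold Rdiv; rewrite Rabs_mult, Rabs_inv, (Rabs_pos_eq x) by lra.
    apply Rle_div_l; [lra|].
    eapply Rle_trans; [exact K2|]; nra. }
  assert (A4 : Rabs (atan (y / x)) <= 4 * m).
  { specialize (H2 (y / x) ltac:(lra)); rewrite Rplus_0_l, atan_0 in H2.
    unfold Rsqr in H2; replace (/ (1 + 0 ^ 2)) with 1 in H2 by field.
    apply Rabs_le_between in A3; apply Rabs_le_between in H2; apply Rabs_le.
    revert H2; unfold Rabs; destruct Rcase_abs; intros; lra. }
  lra.
Qed.

(** The branch of the logarithm on the sector whose imaginary part lies between
    [- alpha] and [beta]; arbitrary outside the sector. *)
Definition sector_log (alpha beta : R) (u : C) : C :=
  epsilon (inhabits (RtoC 0)) (fun zeta => - alpha < snd zeta < beta /\ cexp zeta = u).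

Lemma sector_log_cexp alpha beta zeta : alpha + beta <= 2 * PI ->
  - alpha < snd zeta < beta -> sector_log alpha beta (cexp zeta) = zeta.
Proof.
intros Hab Hz.
assert (Hs : - alpha < snd (sector_log alpha beta (cexp zeta)) < beta /\
  cexp (sector_log alpha beta (cexp zeta)) = cexp zeta).
{ unfold sector_log.
  apply (epsilon_spec (inhabits (RtoC 0)) (fun x => - alpha < snd x < beta /\ cexp x = cexp zeta)).
  now exists zeta. }
destruct Hs as [H1 H2]; apply cexp_injective_strip; [apply Rabs_def1; lra|assumption].
Qed.

Lemma cder_sector_log alpha beta zeta : alpha + beta <= 2 * PI ->
  - alpha < snd zeta < beta ->
  cder (sector_log alpha beta) (cexp zeta) (/ cexp zeta).
Proof.
intros Hab Hz.
assert (Hloc : forall eps, 0 < eps -> exists delta, 0 < delta /\ forall u,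
  Cmod (u - cexp zeta) < delta -> exists xi, u = cexp (zeta + xi) /\ Cmod xi < eps /\
    - alpha < snd (zeta + xi)%C < beta).
{ intros eps Heps.
  set (e := Rmin eps (Rmin (snd zeta + alpha) (beta - snd zeta))).
  assert (He : e <= eps /\ e <= snd zeta + alpha /\ e <= beta - snd zeta).
  { unfold e; pose proof (Rmin_l eps (Rmin (snd zeta + alpha) (beta - snd zeta))).
    pose proof (Rmin_r eps (Rmin (snd zeta + alpha) (beta - snd zeta))).
    pose proof (Rmin_l (snd zeta + alpha) (beta - snd zeta)).
    pose proof (Rmin_r (snd zeta + alpha) (beta - snd zeta)); lra. }
  destruct (cexp_local_inverse e) as (d & Hd & H); [repeat apply Rmin_pos; lra|].
  assert (Hp : 0 < Cmod (cexp zeta)) by apply Cmod_pos, cexp_neq_0.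
  exists (d * Cmod (cexp zeta)); split; [apply Rmult_lt_0_compat; assumption|intros u Hu].
  destruct (H (u / cexp zeta)%C) as (xi & Hxi & Hm).
  { replace (u / cexp zeta - 1)%C with ((u - cexp zeta) / cexp zeta)%C
      by (field; apply cexp_neq_0).
    rewrite Cmod_div by apply cexp_neq_0; apply Rlt_div_l; assumption. }
  exists xi; split; [|split; [lra|]].
  - rewrite cexp_plus, Hxi; field; apply cexp_neq_0.
  - pose proof (snd_le_Cmod xi) as K; apply Rabs_le_between in K; simpl; lra. }
assert (Hcont : ccont (sector_log alpha beta) (cexp zeta)).
{ intros eps Heps; destruct (Hloc eps Heps) as (d & Hd & H).
  exists d; split; [assumption|intros u Hu].
  destruct (H u Hu) as (xi & -> & Hxi & Hr).
  rewrite !sector_log_cexp by assumption.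
  now replace (zeta + xi - zeta)%C with xi by ring. }
destruct (cder_cexp zeta) as (q & Hq & Hqz & H).
destruct (Hloc 1 ltac:(lra)) as (d & Hd & Hd').
apply cder_intro with (fun u => / q (sector_log alpha beta u))%C d; try assumption.
- apply (ccont_comp (fun u => q (sector_log alpha beta u)) Cinv).
  + apply ccont_comp; [assumption|rewrite sector_log_cexp; assumption].
  + rewrite sector_log_cexp, Hqz by assumption; apply ccont_inv, cexp_neq_0.
- rewrite sector_log_cexp, Hqz by assumption; reflexivity.
- intros u Hu; destruct (Hd' u Hu) as (xi & -> & _ & Hr).
  rewrite !sector_log_cexp by assumption.
  set (v := (zeta + xi)%C) in *.
  assert (Hqv : q v <> 0).
  { intros E; assert (Ev := H v); rewrite E in Ev.
    assert (Ez : v = zeta).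
    { apply cexp_injective_strip; [apply Rabs_def1; lra|rewrite Ev; ring]. }
    rewrite Ez in E; rewrite E in Hqz; now apply (cexp_neq_0 zeta). }
  assert (Ev : (cexp v - cexp zeta = q v * (v - zeta))%C) by (rewrite (H v); ring).
  rewrite Ev; field; assumption.
Qed.

(** The half-plane coordinate of the image of [h], with its value at a point
    given in polar form. *)
Lemma sector_halfplane_map h p alpha beta :
  univalent_on_disc h -> 0 < alpha + beta <= 2 * PI ->
  (forall w : C, disc_image h w <->
     exists u : C, sector alpha beta u /\ w = Cplus p (Cmult Ci u)) ->
  exists Phi : C -> C,
    (forall z, disc z -> exists l, cder Phi z l) /\
    (forall z, disc z -> 0 < fst (Phi z)) /\
    (forall z w, disc z -> disc w -> Phi z = Phi w -> z = w) /\
    (forall w : C, 0 < fst w -> exists z, disc z /\ Phi z = w) /\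
    (forall z (x theta : R), disc z -> - alpha < theta < beta ->
       h z = (p + Ci * cexp (x, theta))%C ->
       Phi z = cexp (PI / (alpha + beta) * x,
                     PI / (alpha + beta) * (theta + (alpha - beta) / 2))).
Proof.
intros [Hhd Hhinj] Hab Himage.
set (k := PI / (alpha + beta)).
pose proof PI_RGT_0 as HPI.
assert (Hk : 0 < k) by (apply Rdiv_lt_0_compat; lra).
assert (Hks : k * (alpha + beta) = PI) by (unfold k; field; lra).
set (kap := (0, k * ((alpha - beta) / 2)) : C).
set (Phi := fun z => cexp (RtoC k * sector_log alpha beta ((h z + - p) * / Ci) + kap)%C).
assert (HCi : Ci <> 0) by (intros E; injection E; lra).
assert (Hlog : forall z, disc z -> exists x theta, - alpha < theta < beta /\
  h z = (p + Ci * cexp (x, theta))%C).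
{ intros z Hz; destruct (proj1 (Himage (h z))) as (u & Hu & E); [now exists z|].
  apply sector_cexp in Hu; destruct Hu as ([x theta] & Ht & <-); now exists x, theta. }
assert (Hval : forall z x theta, disc z -> - alpha < theta < beta ->
  h z = (p + Ci * cexp (x, theta))%C ->
  ((h z + - p) * / Ci = cexp (x, theta))%C /\
  Phi z = cexp (k * x, k * (theta + (alpha - beta) / 2))).
{ intros z x theta Hz Ht E.
  assert (E1 : ((h z + - p) * / Ci = cexp (x, theta))%C) by (rewrite E; field; assumption).
  split; [assumption|].
  unfold Phi; rewrite E1, sector_log_cexp by (simpl; lra); f_equal.
  unfold kap, Cplus, Cmult, RtoC; simpl; f_equal; ring. }
assert (Hang : forall theta, - alpha < theta < beta ->
  - (PI / 2) < k * (theta + (alpha - beta) / 2) < PI / 2).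
{ intros theta Ht.
  assert (k * (theta + alpha) > 0) by (apply Rmult_lt_0_compat; lra).
  assert (k * (beta - theta) > 0) by (apply Rmult_lt_0_compat; lra).
  nra. }
exists Phi; repeat split.
- intros z Hz; destruct (Hlog z Hz) as (x & theta & Ht & E).
  destruct (Hval z x theta Hz Ht E) as [E1 _].
  destruct (cder_of_ex_derive h z (Hhd z Hz)) as [l Hl].
  eexists; unfold Phi.
  apply (cder_comp (fun z => RtoC k * sector_log alpha beta ((h z + - p) * / Ci) + kap)%C cexp);
    [|apply cder_cexp].
  apply cder_plus; [|apply cder_const].
  apply cder_mult; [apply cder_const|].
  apply (cder_comp (fun z => (h z + - p) * / Ci)%C (sector_log alpha beta)).
  + apply cder_mult; [apply cder_plus; [exact Hl|]|]; apply cder_const.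
  + rewrite E1; apply cder_sector_log; [lra|exact Ht].
- intros z Hz; destruct (Hlog z Hz) as (x & theta & Ht & E).
  destruct (Hval z x theta Hz Ht E) as [_ ->]; unfold cexp; cbn [fst snd].
  apply Rmult_lt_0_compat; [apply exp_pos|]; apply cos_gt_0; apply Hang; assumption.
- intros z w Hz Hw EP.
  destruct (Hlog z Hz) as (x & theta & Ht & E), (Hlog w Hw) as (x' & theta' & Ht' & E').
  destruct (Hval z x theta Hz Ht E) as [_ Ez], (Hval w x' theta' Hw Ht' E') as [_ Ew].
  rewrite Ez, Ew in EP; apply cexp_injective_strip in EP.
  + injection EP as E1 E2; apply Rmult_eq_reg_l in E1, E2; try lra.
    apply Hhinj; try assumption; rewrite E, E'; do 2 f_equal; f_equal; f_equal; lra.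
  + pose proof (Hang theta Ht); pose proof (Hang theta' Ht'); cbn [snd].
    apply Rabs_def1; lra.
- intros w Hw.
  pose proof (atan_bound (snd w / fst w)) as Hat.
  set (theta := atan (snd w / fst w) / k - (alpha - beta) / 2).
  assert (Ekt : k * (theta + (alpha - beta) / 2) = atan (snd w / fst w)) by (unfold theta; field; lra).
  assert (Ht : - alpha < theta < beta).
  { split; apply Rmult_lt_reg_l with k; try assumption; nra. }
  set (x := ln (Cmod w) / k).
  destruct (proj2 (Himage (p + Ci * cexp (x, theta))%C)) as (z & Hz & E).
  { eexists; split; [apply sector_cexp|reflexivity].
    exists (x, theta); split; [exact Ht|reflexivity]. }
  exists z; split; [assumption|].
  destruct (Hval _ _ _ Hz Ht E) as [_ ->].
  rewrite Ekt; replace (k * x) with (ln (Cmod w)) by (unfold x; field; lra).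
  now apply halfplane_log.
- intros z x theta Hz Ht E; now apply Hval.
Qed.

(** * Speeds and translates in polar coordinates *)

Lemma exp_le_compat x y : x <= y -> exp x <= exp y.
Proof. intros [H| ->]; [left; now apply exp_increasing|apply Rle_refl]. Qed.

(** The three distances at a point whose half-plane coordinate, after an affine
    change, is [exp (k x + i theta)].  The shift by [b] is harmless: where
    [exp (k x)] is large it is negligible, and elsewhere the lower bound on
    [cos theta] keeps the modulus of the coordinate away from zero. *)
Lemma speed_estimates (tau : C) (a b k c1 xmin : R) :
  Cmod tau = 1 -> 0 < a -> 0 < k -> 0 < c1 ->
  exists M, forall (z : C) (x theta : R),
    disc z -> xmin <= x -> c1 * exp (- x) <= cos theta ->
    (RtoC a * cayley tau z + Ci * RtoC b)%C = cexp (k * x, theta) ->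
    Rabs (hyp_dist 0 z - / 2 * (k * x - ln (cos theta))) <= M /\
    Rabs (hyp_dist 0 (proj_diameter tau z) - / 2 * (k * x)) <= M /\
    Rabs (hyp_dist z (proj_diameter tau z) + / 2 * ln (cos theta)) <= M.
Proof.
intros Htau Ha Hk Hc1.
set (Rmin0 := exp (k * xmin)).
assert (HRmin : 0 < Rmin0) by apply exp_pos.
set (B := 2 * Rabs b + 1).
assert (HB : 0 < B) by (pose proof (Rabs_pos b); unfold B; lra).
(* the modulus rho of the coordinate lies between m1 exp (k x) and m2 exp (k x);
   the two terms of m1 correspond to exp (k x) above and below B *)
set (m1 := Rmin (/ (2 * a)) (c1 * exp (- (ln B / k)) / a)).
set (m2 := (1 + Rabs b / Rmin0) / a).
assert (Hm1 : 0 < m1).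
{ apply Rmin_pos; [apply Rinv_0_lt_compat; lra|].
  apply Rdiv_lt_0_compat; [|assumption]; apply Rmult_lt_0_compat; [assumption|apply exp_pos]. }
assert (Hm2 : 0 < m2).
{ apply Rdiv_lt_0_compat; [|assumption].
  assert (0 <= Rabs b / Rmin0) by (apply Rdiv_le_0_compat; [apply Rabs_pos|assumption]); lra. }
(* m1 Rmin0 is a lower bound for rho, hence 1 + rho <= q rho *)
set (q := 1 + / (m1 * Rmin0)).
assert (Hq : 1 < q).
{ assert (0 < / (m1 * Rmin0)) by (apply Rinv_0_lt_compat, Rmult_lt_0_compat; assumption).
  unfold q; lra. }
exists (Rabs (ln m1) + Rabs (ln m2) + Rabs (ln a) + ln q + 3 * ln 2).
intros z x theta Hz Hx Hcos E.
remember (cayley tau z) as w eqn:Ew; symmetry in Ew.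
assert (HX := Re_cayley_pos tau z Htau Hz); rewrite Ew in HX.
set (rho := Cmod w).
assert (HXrho : fst w <= rho).
{ pose proof (fst_le_Cmod w) as K; rewrite Rabs_pos_eq in K by lra; exact K. }
assert (Hrho : 0 < rho) by lra.
set (R0 := exp (k * x)).
assert (HR0 : Rmin0 <= R0) by (apply exp_le_compat, Rmult_le_compat_l; lra).
assert (Hcos0 : 0 < cos theta).
{ pose proof (exp_pos (- x)); pose proof (Rmult_lt_0_compat _ _ Hc1 H); lra. }
assert (EX : a * fst w = R0 * cos theta).
{ apply (f_equal fst) in E; unfold cexp in E; simpl in E; fold R0 in E; lra. }
assert (Haw : Cmod (RtoC a * w) = a * rho).
{ rewrite Cmod_mult, Cmod_R, Rabs_pos_eq by lra; reflexivity. }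
assert (Hib : Cmod (Ci * RtoC b) = Rabs b) by (rewrite Cmod_mult, Cmod_Ci, Cmod_R; ring).
assert (HcR : Cmod (cexp (k * x, theta)) = R0) by (rewrite Cmod_cexp; reflexivity).
assert (Hup : rho <= m2 * R0).
{ assert (K : a * rho <= R0 + Rabs b).
  { rewrite <- Haw, <- HcR, <- Hib, <- E.
    replace (RtoC a * w)%C with ((RtoC a * w + Ci * b) - Ci * b)%C at 1 by ring.
    eapply Rle_trans; [apply Cmod_triangle|rewrite Cmod_opp; apply Rle_refl]. }
  apply Rmult_le_reg_l with a; [assumption|].
  eapply Rle_trans; [exact K|]; unfold m2.
  replace (a * ((1 + Rabs b / Rmin0) / a * R0)) with (R0 + Rabs b * (R0 / Rmin0)) by (field; lra).
  apply Rplus_le_compat_l; rewrite <- (Rmult_1_r (Rabs b)) at 1.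
  apply Rmult_le_compat_l; [apply Rabs_pos|]; apply Rle_div_r; lra. }
assert (Hlow : m1 * R0 <= rho).
{ destruct (Rle_lt_dec B R0) as [HBR|HBR].
  - assert (K : R0 - Rabs b <= a * rho).
    { rewrite <- Haw, <- HcR, <- Hib, <- E.
      pose proof (Cmod_triangle (RtoC a * w) (Ci * b)); lra. }
    apply Rle_trans with (/ (2 * a) * R0).
    + apply Rmult_le_compat_r; [lra|apply Rmin_l].
    + apply Rmult_le_reg_l with a; [assumption|].
      replace (a * (/ (2 * a) * R0)) with (R0 / 2) by (field; lra).
      unfold B in HBR; lra.
  - apply Rle_trans with (c1 * exp (- (ln B / k)) / a * R0).
    + apply Rmult_le_compat_r; [lra|apply Rmin_r].
    + eapply Rle_trans; [|exact HXrho].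
      apply Rmult_le_reg_l with a; [assumption|]; rewrite EX.
      replace (a * (c1 * exp (- (ln B / k)) / a * R0)) with (R0 * (c1 * exp (- (ln B / k))))
        by (field; lra).
      apply Rmult_le_compat_l; [lra|]; eapply Rle_trans; [|exact Hcos].
      apply Rmult_le_compat_l; [lra|]; apply exp_le_compat, Ropp_le_contravar.
      assert (k * x < ln B).
      { rewrite <- (ln_exp (k * x)); apply ln_increasing; [apply exp_pos|assumption]. }
      apply Rle_div_r; lra. }
assert (Hq1 : 1 + rho <= q * rho).
{ assert (m1 * Rmin0 <= rho) by (eapply Rle_trans; [|exact Hlow]; apply Rmult_le_compat_l; lra).
  assert (0 < m1 * Rmin0) by (apply Rmult_lt_0_compat; assumption).
  unfold q; rewrite Rmult_plus_distr_r.
  assert (1 <= / (m1 * Rmin0) * rho).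
  { rewrite Rmult_comm; apply Rle_div_r; lra. }
  lra. }
assert (L1 : ln m1 + k * x <= ln rho <= ln m2 + k * x).
{ rewrite <- (ln_exp (k * x)), <- !ln_mult by first [assumption|apply exp_pos].
  fold R0; split; apply ln_le; try assumption; apply Rmult_lt_0_compat; lra. }
assert (L2 : ln (fst w) = k * x + ln (cos theta) - ln a).
{ assert (K : ln (a * fst w) = ln (R0 * cos theta)) by now rewrite EX.
  rewrite !ln_mult in K by (assumption || lra); unfold R0 in K; rewrite ln_exp in K; lra. }
assert (L4 : ln 4 = 2 * ln 2).
{ replace 4 with (2 * 2) by ring; rewrite ln_mult; lra. }
assert (L4y : forall y, 0 < y -> ln (4 * y) = 2 * ln 2 + ln y).
{ intros y Hy; rewrite ln_mult; lra. }
assert (Hln2 : 0 < ln 2) by (rewrite <- ln_1; apply ln_increasing; lra).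
assert (Hlnq : 0 < ln q) by (rewrite <- ln_1; apply ln_increasing; lra).
pose proof (Rabs_pos (ln m1)) as A1; pose proof (Rabs_pos (ln m2)) as A2.
pose proof (Rabs_pos (ln a)) as A3.
pose proof (Rabs_maj2 (ln m1)) as A4; pose proof (Rle_abs (ln m2)) as A5.
pose proof (Rle_abs (ln a)) as A6; pose proof (Rabs_maj2 (ln a)) as A7.
pose proof (Rle_abs (ln m1)) as A8; pose proof (Rabs_maj2 (ln m2)) as A9.
assert (H0 : disc 0) by (unfold disc; rewrite Cmod_0; lra).
assert (C0 : cayley tau 0 = RtoC 1).
{ unfold cayley; assert (tau <> 0) by (apply Cneq_0; lra).
  replace (tau - 0)%C with tau by ring; field; assumption. }
destruct (proj_diameter_eq tau z Htau Hz) as [Dp Cp]; rewrite Ew in Cp; fold rho in Cp.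
split; [|split].
- assert (K := hyp_dist_bounds tau 0 z Htau H0 Hz); rewrite C0 in K; rewrite Ew in K.
  assert (ER : halfplane_ratio 1 w = (1 + 2 * fst w + rho * rho) / (4 * fst w)).
  { unfold halfplane_ratio, rho; rewrite !Cmod_sqr; destruct w; simpl in *; field; lra. }
  assert (N : rho * rho / (4 * fst w) <= halfplane_ratio 1 w
              <= (q * rho) * (q * rho) / (4 * fst w)).
  { rewrite ER; split; apply Rmult_le_compat_r;
      try (left; apply Rinv_0_lt_compat; lra); [lra|].
    apply Rle_trans with ((1 + rho) * (1 + rho)); [lra|apply Rmult_le_compat; lra]. }
  destruct N as [N1 N2].
  assert (P1 : 0 < rho * rho / (4 * fst w)) by (apply Rdiv_lt_0_compat; nra).
  apply ln_le in N2; [|lra]; apply ln_le in N1; [|assumption].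
  assert (0 < q * rho) by (apply Rmult_lt_0_compat; lra).
  rewrite ln_div, L4y, ln_mult in N1, N2 by nra.
  rewrite (ln_mult q rho) in N2 by lra.
  apply Rabs_le; lra.
- assert (K := hyp_dist_bounds tau 0 _ Htau H0 Dp); rewrite C0, Cp in K.
  assert (ER : halfplane_ratio 1 rho = (1 + rho) * (1 + rho) / (4 * rho)).
  { rewrite halfplane_ratio_real by (simpl; lra); rewrite Cmod_1; simpl; field; lra. }
  assert (N : rho * rho / (4 * rho) <= halfplane_ratio 1 rho
              <= (q * rho) * (q * rho) / (4 * rho)).
  { rewrite ER; split; apply Rmult_le_compat_r;
      try (left; apply Rinv_0_lt_compat; lra); apply Rmult_le_compat; lra. }
  destruct N as [N1 N2].
  assert (P1 : 0 < rho * rho / (4 * rho)) by (apply Rdiv_lt_0_compat; nra).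
  apply ln_le in N2; [|lra]; apply ln_le in N1; [|assumption].
  assert (0 < q * rho) by (apply Rmult_lt_0_compat; lra).
  rewrite ln_div, L4y, ln_mult in N1, N2 by nra.
  rewrite (ln_mult q rho) in N2 by lra.
  apply Rabs_le; lra.
- assert (K := hyp_dist_bounds tau z _ Htau Hz Dp); rewrite Cp in K; rewrite Ew in K.
  assert (ER : halfplane_ratio w rho = (rho + fst w) / (2 * fst w)).
  { rewrite halfplane_ratio_real by assumption; fold rho; field; lra. }
  assert (N : rho / (2 * fst w) <= halfplane_ratio w rho <= (2 * rho) / (2 * fst w)).
  { rewrite ER; split; apply Rmult_le_compat_r;
      try (left; apply Rinv_0_lt_compat; lra); lra. }
  destruct N as [N1 N2].
  assert (P1 : 0 < rho / (2 * fst w)) by (apply Rdiv_lt_0_compat; lra).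
  apply ln_le in N2; [|lra]; apply ln_le in N1; [|assumption].
  rewrite ln_div, (ln_mult 2 (fst w)) in N1, N2 by lra.
  rewrite (ln_mult 2 rho) in N2 by lra.
  apply Rabs_le; lra.
Qed.

Lemma sin_neg_lt_0 y : - PI < y < 0 -> sin y < 0.
Proof.
intros H; assert (0 < sin (- y)) by (apply sin_gt_0; lra); rewrite sin_neg in *; lra.
Qed.

Lemma translation_angle_nonneg (x0 theta0 x theta t : R) :
  0 <= theta0 < PI -> - PI < theta < PI -> 0 <= t ->
  exp x * cos theta = exp x0 * cos theta0 + t ->
  exp x * sin theta = exp x0 * sin theta0 -> 0 <= theta <= theta0.
Proof.
intros H0 H Ht E1 E2.
pose proof (exp_pos x) as Hx; pose proof (exp_pos x0) as Hx0.
assert (Hs0 : 0 <= sin theta0) by (apply sin_ge_0; lra).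
assert (Hth : 0 <= theta).
{ apply Rnot_lt_le; intros Hlt; pose proof (sin_neg_lt_0 theta ltac:(lra)); nra. }
split; [assumption|].
apply Rnot_lt_le; intros Hlt.
assert (K := sin_neg_lt_0 (theta0 - theta) ltac:(lra)).
assert (E : exp x * exp x0 * sin (theta0 - theta) = exp x0 * sin theta0 * t).
{ rewrite sin_minus.
  replace (exp x * exp x0 * (sin theta0 * cos theta - cos theta0 * sin theta)) with
    (exp x0 * sin theta0 * (exp x * cos theta) - exp x0 * cos theta0 * (exp x * sin theta)) by ring.
  rewrite E1, E2; ring. }
assert (0 <= exp x0 * sin theta0 * t) by (repeat apply Rmult_le_pos; lra).
assert (0 < exp x * exp x0) by (apply Rmult_lt_0_compat; assumption).
nra.
Qed.

(** Translating to the right moves the argument towards [0]. *)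
Lemma translation_angle (x0 theta0 x theta t : R) :
  - PI < theta0 < PI -> - PI < theta < PI -> 0 <= t ->
  exp x * cos theta = exp x0 * cos theta0 + t ->
  exp x * sin theta = exp x0 * sin theta0 ->
  0 <= theta <= theta0 \/ theta0 <= theta <= 0.
Proof.
intros H0 H Ht E1 E2.
destruct (Rle_lt_dec 0 theta0) as [Hp|Hn].
- left; apply (translation_angle_nonneg x0 theta0 x theta t); try assumption; lra.
- right; enough (0 <= - theta <= - theta0) by lra.
  apply (translation_angle_nonneg x0 _ x _ t); rewrite ?cos_neg, ?sin_neg; lra.
Qed.

(** With [n = min 1 (1 + cos theta0)] the squared modulus of the translate is at
    least [n (r0^2 + t^2)]. *)
Lemma translation_modulus (theta0 : R) : - PI < theta0 < PI ->
  exists m, 0 < m /\ forall x0 x theta t, 0 <= t ->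
    exp x * cos theta = exp x0 * cos theta0 + t ->
    exp x * sin theta = exp x0 * sin theta0 ->
    m * exp x0 <= exp x /\ m * t <= exp x /\ exp x <= exp x0 + t.
Proof.
intros H0.
assert (Hc : 0 < 1 + cos theta0).
{ assert (Hc2 : 0 < cos (theta0 / 2)) by (apply cos_gt_0; lra).
  replace theta0 with (2 * (theta0 / 2)) by field; rewrite cos_2a_cos; nra. }
pose proof (COS_bound theta0) as Hcb.
set (n := Rmin 1 (1 + cos theta0)).
assert (Hn : 0 < n) by (apply Rmin_pos; lra).
assert (Hn1 : n <= 1) by apply Rmin_l; assert (Hn2 : n <= 1 + cos theta0) by apply Rmin_r.
exists n; split; [assumption|intros x0 x theta t Ht E1 E2].
pose proof (exp_pos x) as Hx; pose proof (exp_pos x0) as Hx0.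
set (r := exp x) in *; set (r0 := exp x0) in *.
assert (E : r * r = r0 * r0 + t * t + 2 * (r0 * t) * cos theta0).
{ pose proof (sin2_cos2 theta) as S1; pose proof (sin2_cos2 theta0) as S2; unfold Rsqr in *.
  transitivity ((r * cos theta) * (r * cos theta) + (r * sin theta) * (r * sin theta)); [nra|].
  rewrite E1, E2.
  transitivity (r0 * r0 * (sin theta0 * sin theta0 + cos theta0 * cos theta0)
    + t * t + 2 * (r0 * t) * cos theta0); [ring|rewrite S2; ring]. }
assert (Hrt : 0 <= r0 * t) by (apply Rmult_le_pos; lra).
assert (Hlow : n * (r0 * r0 + t * t) <= r * r).
{ rewrite E; pose proof (Rle_0_sqr (r0 - t)) as K; unfold Rsqr in K.
  destruct (Rle_lt_dec 0 (cos theta0)) as [Hp|Hm].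
  - assert (0 <= 2 * (r0 * t) * cos theta0) by (apply Rmult_le_pos; lra).
    assert (n * (r0 * r0 + t * t) <= 1 * (r0 * r0 + t * t)) by (apply Rmult_le_compat_r; nra).
    lra.
  - assert (n * (r0 * r0 + t * t) <= (1 + cos theta0) * (r0 * r0 + t * t))
      by (apply Rmult_le_compat_r; nra).
    assert (cos theta0 * (r0 * r0 + t * t) <= cos theta0 * (2 * (r0 * t))) by nra.
    lra. }
assert (Hnn : n * n <= n) by nra.
assert (Haux : forall s, 0 <= s -> n * (s * s) <= r * r -> n * s <= r).
{ intros s Hs Hsr; apply Rnot_lt_le; intros Hlt.
  assert (r * r < (n * s) * (n * s)) by nra.
  assert (n * n * (s * s) <= n * (s * s)) by (apply Rmult_le_compat_r; nra).
  nra. }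
split; [|split].
- apply Haux; [lra|]; assert (0 <= n * (t * t)) by (apply Rmult_le_pos; nra); lra.
- apply Haux; [lra|]; assert (0 <= n * (r0 * r0)) by (apply Rmult_le_pos; nra); lra.
- apply Rnot_lt_le; intros Hlt.
  assert ((r0 * t) * cos theta0 <= (r0 * t) * 1) by (apply Rmult_le_compat_l; lra).
  nra.
Qed.

Lemma sin_lower_bound (x m : R) : 0 <= x <= m -> m < PI ->
  x * (cos (m / 2) * cos (m / 2)) <= sin x.
Proof.
intros Hx Hm.
assert (Hy : forall y, 0 <= y < PI / 2 -> y * cos y <= sin y).
{ intros y Hy.
  destruct (MVT_gen sin 0 y cos) as (c & Hc & E).
  - intros u _; apply is_derive_Reals, derivable_pt_lim_sin.
  - intros u _; apply derivable_continuous_pt, derivable_pt_sin.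
  - rewrite Rmin_left, Rmax_right in Hc by lra.
    rewrite sin_0 in E; replace (sin y) with (cos c * y) by lra.
    rewrite Rmult_comm; apply Rmult_le_compat_r; [lra|].
    apply cos_decr_1; lra. }
replace (sin x) with (2 * sin (x / 2) * cos (x / 2)).
2:{ rewrite <- sin_2a; f_equal; field. }
specialize (Hy (x / 2) ltac:(lra)).
assert (H1 : cos (m / 2) <= cos (x / 2)) by (apply cos_decr_1; lra).
assert (H2 : 0 < cos (m / 2)) by (apply cos_gt_0; lra).
assert (cos (m / 2) * cos (m / 2) <= cos (x / 2) * cos (x / 2)) by (apply Rmult_le_compat; lra).
assert (x * (cos (m / 2) * cos (m / 2)) <= x * (cos (x / 2) * cos (x / 2)))
  by (apply Rmult_le_compat_l; lra).
assert (x / 2 * cos (x / 2) * cos (x / 2) <= sin (x / 2) * cos (x / 2))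
  by (apply Rmult_le_compat_r; lra).
lra.
Qed.

(** As the imaginary part is constant, [sin theta] is proportional to
    [exp (- x)], and [sin (k theta)] is comparable to it. *)
Lemma boundary_angle_decay (k x0 theta0 : R) :
  0 < k -> 0 < theta0 < PI -> k * theta0 < PI ->
  exists c1 c2, 0 < c1 /\ 0 < c2 /\ forall x theta, 0 <= theta <= theta0 ->
    exp x * sin theta = exp x0 * sin theta0 ->
    c1 * exp (- x) <= sin (k * theta) <= c2 * exp (- x).
Proof.
intros Hk H0 Hk0.
assert (Hc1 : 0 < cos (k * theta0 / 2)) by (apply cos_gt_0; nra).
assert (Hc2 : 0 < cos (theta0 / 2)) by (apply cos_gt_0; lra).
set (y := exp x0 * sin theta0).
assert (Hy : 0 < y) by (apply Rmult_lt_0_compat; [apply exp_pos|apply sin_gt_0; lra]).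
set (d1 := cos (k * theta0 / 2) * cos (k * theta0 / 2)).
set (d2 := cos (theta0 / 2) * cos (theta0 / 2)).
assert (Hd1 : 0 < d1) by (apply Rmult_lt_0_compat; assumption).
assert (Hd2 : 0 < d2) by (apply Rmult_lt_0_compat; assumption).
exists (k * d1 * y), (k / d2 * y); split; [|split].
- apply Rmult_lt_0_compat; [apply Rmult_lt_0_compat|]; assumption.
- apply Rmult_lt_0_compat; [apply Rdiv_lt_0_compat|]; assumption.
- intros x theta Ht E; fold y in E.
  assert (Es : sin theta = y * exp (- x)).
  { rewrite <- E, exp_Ropp; field; apply Rgt_not_eq, exp_pos. }
  assert (Hst : sin theta <= theta).
  { destruct (Req_dec theta 0) as [->|Hn]; [rewrite sin_0; lra|].
    left; apply sin_lt_x; lra. }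
  assert (Hkt : 0 <= k * theta <= k * theta0) by (split; [apply Rmult_le_pos|apply Rmult_le_compat_l]; lra).
  split.
  + rewrite Rmult_assoc, <- Es.
    eapply Rle_trans; [|apply (sin_lower_bound (k * theta) (k * theta0)); lra].
    fold d1; assert (k * d1 * sin theta <= k * d1 * theta).
    { apply Rmult_le_compat_l; [apply Rmult_le_pos; lra|assumption]. }
    lra.
  + rewrite Rmult_assoc, <- Es.
    apply Rle_trans with (k * theta).
    * destruct (Req_dec (k * theta) 0) as [->|Hn]; [rewrite sin_0; lra|].
      left; apply sin_lt_x; lra.
    * assert (K := sin_lower_bound theta theta0 Ht (proj2 H0)); fold d2 in K.
      replace (k / d2 * sin theta) with (k * (sin theta / d2)) by (field; lra).
      apply Rmult_le_compat_l; [lra|apply Rle_div_r; lra].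
Qed.

(** * The speeds of the semigroup *)

Lemma locally_Cmod_lt (tau : C) eps : 0 < eps -> locally tau (fun w => Cmod (w - tau) < eps).
Proof.
intros Heps; assert (He : 0 < eps / 2) by lra.
exists (mkposreal _ He); intros w [H1 H2].
change (Rabs (fst w - fst tau) < eps / 2) in H1.
change (Rabs (snd w - snd tau) < eps / 2) in H2.
eapply Rle_lt_trans; [apply Cmod_le_abs|].
change (Rabs (fst w - fst tau) + Rabs (snd w - snd tau) < eps); lra.
Qed.

(** The orbit of [0] in polar coordinates, with its position in the disc read
    off in the half-plane coordinate attached to [tau]. *)
Lemma koenigs_sector_trajectory phi tau h p alpha beta :
  nonelliptic_semigroup phi -> is_denjoy_wolff_point phi tau -> is_koenigs_function phi h ->
  0 <= alpha <= PI -> 0 <= beta <= PI -> 0 < alpha + beta ->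
  (forall w : C, disc_image h w <->
     exists u : C, sector alpha beta u /\ w = Cplus p (Cmult Ci u)) ->
  exists a b x0 theta0 : R, 0 < a /\ - alpha < theta0 < beta /\
    forall t, 0 <= t -> exists x theta, - alpha < theta < beta /\
      exp x * cos theta = exp x0 * cos theta0 + t /\
      exp x * sin theta = exp x0 * sin theta0 /\
      (RtoC a * cayley tau (phi t 0) + Ci * RtoC b)%C
      = cexp (PI / (alpha + beta) * x, PI / (alpha + beta) * (theta + (alpha - beta) / 2)).
Proof.
intros Hphi [Htau Hlim] Hh Ha Hb Hab Himage.
pose proof PI_RGT_0 as HPI.
set (k := PI / (alpha + beta)).
assert (Hk : 0 < k) by (apply Rdiv_lt_0_compat; lra).
assert (H0 : disc 0) by (unfold disc; rewrite Cmod_0; lra).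
assert (Hz : forall t, 0 <= t -> disc (phi t 0)).
{ intros t Ht; now apply (semigroup_self_map phi Hphi). }
destruct (sector_halfplane_map h p alpha beta (koenigs_univalent phi h Hh) ltac:(lra) Himage)
  as (Phi & Hd & Hpos & Hinj & Hsurj & Hval).
assert (Hpolar : forall z, disc z -> exists x theta, - alpha < theta < beta /\
  h z = (p + Ci * cexp (x, theta))%C).
{ intros z Dz; destruct (proj1 (Himage (h z))) as (u & Hu & E); [now exists z|].
  apply sector_cexp in Hu; destruct Hu as ([x theta] & Ht & <-); now exists x, theta. }
destruct (Hpolar 0 H0) as (x0 & theta0 & Ht0 & E0).
assert (Htraj : forall t, 0 <= t -> exists x theta, - alpha < theta < beta /\
  exp x * cos theta = exp x0 * cos theta0 + t /\
  exp x * sin theta = exp x0 * sin theta0 /\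
  Phi (phi t 0) = cexp (k * x, k * (theta + (alpha - beta) / 2))).
{ intros t Ht; destruct (Hpolar _ (Hz t Ht)) as (x & theta & Hth & E).
  assert (E1 : cexp (x, theta) = (cexp (x0, theta0) + RtoC t)%C).
  { assert (HCi : Ci <> 0) by (intros E2; injection E2; lra).
    replace (cexp (x, theta)) with ((p + Ci * cexp (x, theta) - p) / Ci)%C by (field; assumption).
    rewrite <- E, (koenigs_conjugation phi h Hh t 0 Ht H0), E0; field; assumption. }
  exists x, theta; split; [assumption|].
  unfold cexp, Cplus in E1; simpl in E1; injection E1 as R1 R2.
  split; [assumption|split; [lra|apply (Hval _ x theta); auto]]. }
destruct (translation_modulus theta0 ltac:(lra)) as (m & Hm & Hmod).
destruct (halfplane_bijection_normal_form Phi tau Htau Hd Hpos Hinj Hsurj) as (a & b & Hapos & Hnf).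
- intros eps M Heps.
  destruct (Hlim 0 H0 _ (locally_Cmod_lt tau eps Heps)) as [T HT].
  set (y := exp (ln (Rabs M + 1) / k) / m).
  assert (Hy : 0 < y) by (apply Rdiv_lt_0_compat; [apply exp_pos|assumption]).
  set (t := Rmax (T + 1) y).
  pose proof (Rmax_l (T + 1) y : T + 1 <= t); pose proof (Rmax_r (T + 1) y : y <= t).
  assert (Ht : 0 <= t) by lra.
  exists (phi t 0); split; [now apply Hz|split; [apply HT; lra|]].
  destruct (Htraj t Ht) as (x & theta & Hth & R1 & R2 & ->).
  destruct (Hmod _ _ _ _ Ht R1 R2) as (_ & K & _).
  rewrite Cmod_cexp; simpl.
  assert (Kx : exp (ln (Rabs M + 1) / k) <= exp x).
  { eapply Rle_trans; [|exact K].
    replace (exp (ln (Rabs M + 1) / k)) with (m * y) by (unfold y; field; lra).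
    apply Rmult_le_compat_l; lra. }
  assert (Kx' : ln (Rabs M + 1) / k <= x).
  { apply Rnot_lt_le; intros Hlt; apply exp_increasing in Hlt; lra. }
  apply Rle_div_l in Kx'; [|assumption].
  pose proof (Rle_abs M); pose proof (Rabs_pos M).
  apply Rlt_le_trans with (exp (ln (Rabs M + 1))); [rewrite exp_ln; lra|].
  apply exp_le_compat; lra.
- exists a, b, x0, theta0; split; [assumption|split; [assumption|]].
  intros t Ht; destruct (Htraj t Ht) as (x & theta & Hth & R1 & R2 & E).
  exists x, theta; repeat (split; [assumption|]).
  rewrite <- Hnf by now apply Hz.
  exact E.
Qed.

Theorem proposition6p5 (phi : R -> C -> C) (tau : C) (h : C -> C)
    (p : C) (alpha beta : R)
    (Hphi : nonelliptic_semigroup phi)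
    (Htau : is_denjoy_wolff_point phi tau)
    (Hh : is_koenigs_function phi h)
    (Halpha : 0 <= alpha <= PI) (Hbeta : 0 <= beta <= PI)
    (Hsum : 0 < alpha + beta)
    (Himage : forall w : C, disc_image h w <->
       exists u : C, sector alpha beta u /\ w = Cplus p (Cmult Ci u)) :
  (0 < alpha -> 0 < beta ->
    exists c : R, 0 < c /\
      (forall t : R, 0 <= t -> tangential_speed phi tau t <= c) /\
      (forall t : R, 1 <= t ->
        Rabs (orthogonal_speed phi tau t
              - PI / (2 * (alpha + beta)) * ln t) <= c /\
        Rabs (total_speed phi t - PI / (2 * (alpha + beta)) * ln t) <= c))
  /\
  (alpha = 0 \/ beta = 0 ->
    exists c : R, 0 < c /\
      forall t : R, 1 <= t ->
        Rabs (total_speed phi t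
              - (PI + alpha + beta) / (2 * (alpha + beta)) * ln t) <= c /\
        Rabs (orthogonal_speed phi tau t
              - PI / (2 * (alpha + beta)) * ln t) <= c /\
        Rabs (tangential_speed phi tau t - / 2 * ln t) <= c).
Proof.
pose proof PI_RGT_0 as HPI.
destruct (koenigs_sector_trajectory phi tau h p alpha beta Hphi Htau Hh Halpha Hbeta Hsum Himage)
  as (a & b & x0 & theta0 & Ha & Ht0 & Htraj).
destruct Htau as [Htau _].
set (k := PI / (alpha + beta)) in *.
assert (Hk : 0 < k) by (apply Rdiv_lt_0_compat; lra).
assert (Hks : k * (alpha + beta) = PI) by (unfold k; field; lra).
assert (Ek : PI / (2 * (alpha + beta)) = k / 2) by (unfold k; field; lra).
assert (Ek' : (PI + alpha + beta) / (2 * (alpha + beta)) = (k + 1) / 2) by (unfold k; field; lra).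
rewrite Ek, Ek'.
assert (Hz : forall t, 0 <= t -> disc (phi t 0)).
{ intros t Ht; apply (semigroup_self_map phi Hphi); [assumption|unfold disc; rewrite Cmod_0; lra]. }
destruct (translation_modulus theta0 ltac:(lra)) as (m & Hm & Hmod).
pose proof (exp_pos x0) as Hx0.
(* the modulus exp x of the translate is comparable to t *)
set (xmin := ln m + x0).
assert (Hxmin : forall x, m * exp x0 <= exp x -> xmin <= x).
{ intros x Hx; unfold xmin; rewrite <- (ln_exp x0), <- ln_mult by assumption.
  rewrite <- (ln_exp x); apply ln_le; [apply Rmult_lt_0_compat; assumption|assumption]. }
set (Cx := Rabs (ln m) + ln (exp x0 + 1)).
assert (Hlx : 0 < ln (exp x0 + 1)) by (rewrite <- ln_1; apply ln_increasing; lra).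
assert (HCx : forall x t, 1 <= t -> m * t <= exp x -> exp x <= exp x0 + t ->
  - Cx <= x - ln t <= Cx).
{ intros x t Ht K1 K2; unfold Cx.
  pose proof (Rle_abs (ln m)); pose proof (Rabs_maj2 (ln m)).
  assert (K1' : ln (m * t) <= ln (exp x)).
  { apply ln_le; [apply Rmult_lt_0_compat; lra|assumption]. }
  assert (K2' : ln (exp x) <= ln ((exp x0 + 1) * t)).
  { apply ln_le; [apply exp_pos|].
    assert (exp x0 * 1 <= exp x0 * t) by (apply Rmult_le_compat_l; lra); lra. }
  rewrite ln_exp, ln_mult in K1', K2' by lra.
  pose proof (Rabs_pos (ln m)); lra. }
assert (HCx0 : 0 <= Cx) by (unfold Cx; pose proof (Rabs_pos (ln m)); lra).
assert (HkCx : forall u, - Cx <= u <= Cx -> - (k * Cx) <= k * u <= k * Cx).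
{ intros u Hu; split; [|apply Rmult_le_compat_l; lra].
  replace (- (k * Cx)) with (k * - Cx) by ring; apply Rmult_le_compat_l; lra. }
assert (HkCx0 : 0 <= k * Cx) by (apply Rmult_le_pos; lra).
unfold orthogonal_speed, total_speed, tangential_speed.
split.
- intros Ha0 Hb0.
  set (kap := k * ((alpha - beta) / 2)).
  set (th := k * (theta0 + (alpha - beta) / 2)).
  (* the half-plane argument stays between kap and th, both interior *)
  set (mu := Rmax (Rabs kap) (Rabs th)).
  assert (Hmu : 0 <= mu < PI / 2).
  { split; [eapply Rle_trans; [apply Rabs_pos|apply Rmax_l]|].
    assert (k * alpha > 0 /\ k * beta > 0) by (split; apply Rmult_lt_0_compat; lra).
    assert (k * (theta0 + alpha) > 0 /\ k * (beta - theta0) > 0)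
      by (split; apply Rmult_lt_0_compat; lra).
    apply Rmax_lub_lt; apply Rabs_def1; unfold kap, th; lra. }
  set (c0 := cos mu).
  assert (Hc0 : 0 < c0) by (apply cos_gt_0; lra).
  assert (Hcos : forall theta, 0 <= theta <= theta0 \/ theta0 <= theta <= 0 ->
    c0 <= cos (k * (theta + (alpha - beta) / 2)) <= 1).
  { intros theta Hth; split; [|apply COS_bound].
    set (T := k * (theta + (alpha - beta) / 2)).
    assert (HT : Rabs T <= mu).
    { assert (B : kap <= T <= th \/ th <= T <= kap).
      { destruct Hth; [left|right]; unfold kap, T, th; split;
          apply Rmult_le_compat_l; lra. }
      pose proof (Rmax_l (Rabs kap) (Rabs th) : Rabs kap <= mu) as M1.
      pose proof (Rmax_r (Rabs kap) (Rabs th) : Rabs th <= mu) as M2.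
      apply Rabs_le_between in M1; apply Rabs_le_between in M2; apply Rabs_le.
      destruct B; lra. }
    replace (cos T) with (cos (Rabs T)).
    - pose proof (Rabs_pos T); apply cos_decr_1; lra.
    - unfold Rabs; destruct Rcase_abs; [apply cos_neg|reflexivity]. }
  set (c1 := c0 * exp xmin).
  assert (Hc1 : 0 < c1) by (apply Rmult_lt_0_compat; [assumption|apply exp_pos]).
  destruct (speed_estimates tau a b k c1 xmin Htau Ha Hk Hc1) as [M HM].
  assert (Hall : forall t, 0 <= t -> exists x l,
    (1 <= t -> - Cx <= x - ln t <= Cx) /\ ln c0 <= l <= 0 /\
    Rabs (hyp_dist 0 (phi t 0) - / 2 * (k * x - l)) <= M /\
    Rabs (hyp_dist 0 (proj_diameter tau (phi t 0)) - / 2 * (k * x)) <= M /\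
    Rabs (hyp_dist (phi t 0) (proj_diameter tau (phi t 0)) + / 2 * l) <= M).
  { intros t Ht; destruct (Htraj t Ht) as (x & theta & Hth & R1 & R2 & E).
    destruct (Hmod _ _ _ _ Ht R1 R2) as (K1 & K2 & K3).
    assert (Hang := translation_angle x0 theta0 x theta t ltac:(lra) ltac:(lra) Ht R1 R2).
    apply Hcos in Hang; apply Hxmin in K1 as K1'.
    exists x, (ln (cos (k * (theta + (alpha - beta) / 2)))).
    split; [auto|split].
    - split; [apply ln_le; tauto|rewrite <- ln_1; apply ln_le; lra].
    - apply HM; auto.
      unfold c1; rewrite Rmult_assoc, <- exp_plus.
      assert (exp (xmin + - x) <= 1).
      { rewrite <- exp_0; apply exp_le_compat; lra. }
      assert (c0 * exp (xmin + - x) <= c0 * 1) by (apply Rmult_le_compat_l; lra).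
      lra. }
  exists (Rabs M + k * Cx + Rabs (ln c0) + 1).
  pose proof (Rle_abs M); pose proof (Rabs_pos M).
  pose proof (Rabs_pos (ln c0)); pose proof (Rabs_maj2 (ln c0)).
  split; [lra|split].
  + intros t Ht; destruct (Hall t Ht) as (x & l & _ & Hl & _ & _ & B).
    apply Rabs_le_between in B; lra.
  + intros t Ht; destruct (Hall t ltac:(lra)) as (x & l & Hx & Hl & B1 & B2 & _).
    specialize (HkCx _ (Hx Ht)).
    apply Rabs_le_between in B1; apply Rabs_le_between in B2.
    split; apply Rabs_le; lra.
- intros H0.
  assert (Hne : theta0 <> 0) by (destruct H0; lra).
  assert (Hs0 : 0 < Rabs theta0) by now apply Rabs_pos_lt.
  assert (Hs1 : Rabs theta0 < alpha + beta) by (apply Rabs_def1; lra).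
  (* theta keeps the sign of theta0, and the half-plane cosine is sin (k |theta|) *)
  destruct (boundary_angle_decay k x0 (Rabs theta0) Hk) as (c1 & c2 & Hc1 & Hc2 & Hdec).
  { destruct H0; lra. }
  { rewrite <- Hks; apply Rmult_lt_compat_l; lra. }
  assert (Hcos : forall x theta, 0 <= theta <= theta0 \/ theta0 <= theta <= 0 ->
    exp x * sin theta = exp x0 * sin theta0 ->
    c1 * exp (- x) <= cos (k * (theta + (alpha - beta) / 2)) <= c2 * exp (- x)).
  { intros x theta Hth E; destruct H0 as [H0|H0].
    - replace (cos (k * (theta + (alpha - beta) / 2))) with (sin (k * theta)).
      + rewrite Rabs_pos_eq in Hdec by lra; apply Hdec; [lra|assumption].
      + replace (k * (theta + (alpha - beta) / 2)) with (- (PI / 2 - k * theta))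
          by (rewrite <- Hks, H0; field).
        now rewrite cos_neg, cos_shift.
    - replace (cos (k * (theta + (alpha - beta) / 2))) with (sin (k * - theta)).
      + rewrite Rabs_left in Hdec by lra; apply Hdec; [lra|rewrite !sin_neg; lra].
      + replace (k * (theta + (alpha - beta) / 2)) with (PI / 2 - k * - theta)
          by (rewrite <- Hks, H0; field).
        now rewrite cos_shift. }
  destruct (speed_estimates tau a b k c1 xmin Htau Ha Hk Hc1) as [M HM].
  exists (Rabs M + (k + 1) * Cx + Rabs (ln c1) + Rabs (ln c2) + 1).
  pose proof (Rle_abs M); pose proof (Rabs_pos M).
  pose proof (Rabs_pos (ln c1)); pose proof (Rabs_maj2 (ln c1)).
  pose proof (Rabs_pos (ln c2)); pose proof (Rle_abs (ln c2)).
  split; [lra|].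
  intros t Ht; destruct (Htraj t ltac:(lra)) as (x & theta & Hth & R1 & R2 & E).
  destruct (Hmod x0 x theta t ltac:(lra) R1 R2) as (K1 & K2 & K3).
  assert (Hang := translation_angle x0 theta0 x theta t ltac:(lra) ltac:(lra) ltac:(lra) R1 R2).
  destruct (Hcos x theta Hang R2) as [L1 L2].
  destruct (HM (phi t 0) x (k * (theta + (alpha - beta) / 2))) as (B1 & B2 & B3); auto.
  { apply Hz; lra. }
  assert (P : 0 < c1 * exp (- x)) by (apply Rmult_lt_0_compat; [assumption|apply exp_pos]).
  apply ln_le in L2; [|lra]; apply ln_le in L1; [|assumption].
  rewrite ln_mult, ln_exp in L1, L2 by first [assumption|apply exp_pos].
  assert (Hx := HCx x t Ht K2 K3).
  specialize (HkCx _ Hx).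
  apply Rabs_le_between in B1; apply Rabs_le_between in B2; apply Rabs_le_between in B3.
  repeat split; apply Rabs_le; lra.
Qed.
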